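(* Let $\beta>0$ and let $s\ge0$ be fixed. For each $N$ let $\eta=(\eta^{(a)}_1,\dots,\eta^{(a)}_N,\eta^{(b)}_1,\dots,\eta^{(b)}_{N-1})$ be nonnegative exponents with $\sum_{j=1}^N\eta^{(a)}_j+\sum_{j=1}^{N-1}\eta^{(b)}_j=s$, such that the moment $M(N,\eta)$ is defined and nonzero. Then $$\lim_{N\to\infty}\frac{M_r(N,\eta)}{M(N,\eta)}=1 .$$
   Context: For $\beta>0$ and $N\ge2$ consider real symmetric tridiagonal $N\times N$ matrices $H_\beta$ with diagonal entries $a_N,a_{N-1},\dots,a_1$ (from top to bottom) and sub/superdiagonal entries $b_{N-1},b_{N-2},\dots,b_1$, where $a_j\in\mathbb{R}$ and $b_j>0$, so that $\mathrm{tr}\,H_\beta^2=\sum_{j=1}^N a_j^2+2\sum_{j=1}^{N-1}b_j^2$. Write $da=\prod_{j=1}^N da_j$, $db=\prod_{j=1}^{N-1}db_j$. The $\beta$-Hermite (tridiagonal matrix) ensemble is the probability distribution of $(a,b)$ with density $$P(H_\beta)=K^{-1}\exp\big(-\tfrac12\mathrm{tr}\,H_\beta^2\big)\prod_{j=1}^{N-1}b_j^{j\beta-1}$$ with respect to $da\,db$, where $K$ is the normalization constant (equivalently, the entries are independent, $a_j\sim N(0,1)$ and $\sqrt2\,b_j\sim\chi_{j\beta}$). Expectation in this ensemble is denoted $\langle\cdot\rangle$. The fixed trace ensemble of strength $r>0$ is the probability distribution of $(a,b)$ with (formal) density $$P_r(H_\beta)=K_r^{-1}\,\delta\Big(\frac{1}{r^2}\mathrm{tr}\,H_\beta^2-1\Big)\prod_{j=1}^{N-1}b_j^{j\beta-1}$$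 with respect to $da\,db$, where $K_r$ is the normalization constant (equivalently, the distribution of $r\,H_\beta/\sqrt{\mathrm{tr}\,H_\beta^2}$ with $H_\beta$ drawn from the $\beta$-Hermite ensemble). Expectation in this ensemble is denoted $\langle\cdot\rangle_r$. The strength is chosen, depending on $N$, so that $$r^2=\langle\mathrm{tr}\,H_\beta^2\rangle=N+\frac{\beta N(N-1)}{2}.$$ The moments are $$M_r(N,\eta)=\Big\langle\prod_{j=1}^N a_j^{\eta^{(a)}_j}\prod_{j=1}^{N-1}b_j^{\eta^{(b)}_j}\Big\rangle_r,\qquad M(N,\eta)=\Big\langle\prod_{j=1}^N a_j^{\eta^{(a)}_j}\prod_{j=1}^{N-1}b_j^{\eta^{(b)}_j}\Big\rangle .$$ *)

(* Defs.v *)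
From HB Require Import structures.
From mathcomp Require Import all_boot all_order all_algebra.
From mathcomp Require Import all_classical all_reals all_analysis.
From mathcomp Require Import measurable_realfun.

Set Implicit Arguments.
Unset Strict Implicit.
Unset Printing Implicit Defensive.

Import Order.TTheory GRing.Theory Num.Theory.
Import numFieldNormedType.Exports.

Local Open Scope classical_set_scope.
Local Open Scope ring_scope.

Section lebesgue_tuple.
Variable R : realType.
Notation RT := (measurableTypeR R).

Definition tcons n (z : RT * n.-tuple RT) : n.+1.-tuple RT :=
  [tuple of z.1 :: z.2].

Lemma measurable_tcons n : measurable_fun setT (@tcons n).
Proof. exact: measurable_cons. Qed.

Section step.
Variables (n : nat) (mu : {sigma_finite_measure set (n.-tuple RT) -> \bar R}).

Definition lebesgue_step : set (n.+1.-tuple RT) -> \bar R :=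
  pushforward (lebesgue_measure \x mu)%E (@tcons n).

Let lebesgue_step0 : lebesgue_step set0 = 0%E.
Proof. by rewrite /lebesgue_step /pushforward preimage_set0 measure0. Qed.

Let lebesgue_step_ge0 A : (0 <= lebesgue_step A)%E.
Proof. exact: (measure_ge0 (lebesgue_measure \x mu)%E). Qed.

Let lebesgue_step_sigma_additive : semi_sigma_additive lebesgue_step.
Proof.
have mP A : measurable A -> measurable (@tcons n @^-1` A).
  by move=> mA; rewrite -[X in measurable X]setTI; exact: measurable_tcons.
move=> F mF tF mUF; rewrite /lebesgue_step /pushforward preimage_bigcup.
apply: (@measure_semi_sigma_additive _ _ _ (lebesgue_measure \x mu)%E).
- by move=> k; exact: mP.
- apply/trivIsetP => /= i j _ _ ij; rewrite -preimage_setI.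
  by move/trivIsetP : tF => /(_ _ _ _ _ ij) ->//; rewrite preimage_set0.
- by rewrite -preimage_bigcup; exact: mP.
Qed.

HB.instance Definition _ := isMeasure.Build _ _ _ lebesgue_step
  lebesgue_step0 lebesgue_step_ge0 lebesgue_step_sigma_additive.

Let sigma_finite_lebesgue_step : sigma_finite setT lebesgue_step.
Proof.
have /sigma_finiteP[F [TF ndF Foo]] := sigma_finiteT (@lebesgue_measure R).
have /sigma_finiteP[G [TG ndG Goo]] := sigma_finiteT mu.
pose u (t : n.+1.-tuple RT) : RT * n.-tuple RT :=
  (tnth t ord0, [tuple of behead t]).
have tconsK : cancel (@tcons n) u.
  by move=> [x t]; congr pair; exact: val_inj.
have um : measurable_fun setT u.
  by apply: measurable_fun_pair; [exact: measurable_tnth|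
                                  exact: measurable_behead].
exists (fun k => u @^-1` (F k `*` G k)).
  rewrite -preimage_bigcup; apply/esym/seteqP; split=> // t _.
  have [[i _ Fi] [k _ Gk]] : (\bigcup_k F k) (u t).1 /\ (\bigcup_k G k) (u t).2.
    by rewrite -TF -TG.
  exists (maxn i k) => //; split.
  - exact: (subsetPset _ _ (ndF _ _ (leq_maxl i k))).
  - exact: (subsetPset _ _ (ndG _ _ (leq_maxr i k))).
move=> k; have [mF Fk] := Foo k; have [mG Gk] := Goo k.
have mFG : measurable (F k `*` G k) by exact: measurableX.
split; first by rewrite -[X in measurable X]setTI; exact: um.
rewrite /lebesgue_step /pushforward -comp_preimage.
rewrite (_ : u \o _ = id); last by apply/funext => z; exact: tconsK.
by rewrite preimage_id product_measure1E// lte_mul_pinfty// ge0_fin_numE.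
Qed.

HB.instance Definition _ := Measure_isSigmaFinite.Build _ _ _ lebesgue_step
  sigma_finite_lebesgue_step.

End step.

(* n-dimensional Lebesgue measure, by iterated products.  The structure of
   sigma-finite measure is carried along because the library's product measure
   needs it on its second factor. *)
Fixpoint lebesgue_tuple n : {sigma_finite_measure set (n.-tuple RT) -> \bar R} :=
  match n with
  | 0 => dirac [tuple]
  | n'.+1 => lebesgue_step (lebesgue_tuple n')
  end.

End lebesgue_tuple.

Section ensemble.
Variable R : realType.
Notation RT := (measurableTypeR R).

(* The entries (a, b) of an N x N matrix H_beta.  Indices are shifted: a_j and
   b_j of the mathematical text, j >= 1, are the components of index j - 1. *)
Local Notation entries N := (N.-tuple RT * N.-1.-tuple RT)%type.

(* The diagonal reads a_N, ..., a_1 and the off-diagonals b_(N-1), ..., b_1 from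
   top to bottom. *)
Definition hermite_mx N (x : entries N) : 'M[R]_N :=
  \matrix_(i, j)
    if i == j then tnth x.1 (rev_ord i)
    else if (j == i.+1 :> nat) then nth 0 x.2 (N - j.+1)
    else if (i == j.+1 :> nat) then nth 0 x.2 (N - i.+1)
    else 0.

Definition trace_sq N (x : entries N) : R :=
  \tr (hermite_mx x *m hermite_mx x).

Definition b_positive N : set (entries N) :=
  [set x | forall j, 0 < tnth x.2 j].

(* Unnormalized density; its domain is b_positive. *)
Definition hermite_weight N (beta : R) (x : entries N) : R :=
  expR (- (trace_sq x / 2)) *
  \prod_(j < N.-1) (tnth x.2 j : R) `^ (j.+1%:R * beta - 1).

Lemma measurable_a N (j : 'I_N) :
  measurable_fun setT (fun x : entries N => tnth x.1 j : R).
Proof. exact: (measurableT_comp (measurable_tnth j) measurable_fst). Qed.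

Lemma measurable_b N (j : 'I_N.-1) :
  measurable_fun setT (fun x : entries N => tnth x.2 j : R).
Proof. exact: (measurableT_comp (measurable_tnth j) measurable_snd). Qed.

Lemma measurable_nth_b N (k : nat) :
  measurable_fun setT (fun x : entries N => nth 0 x.2 k : R).
Proof.
have [kN|Nk] := ltnP k N.-1.
  have -> : (fun x : entries N => nth 0 x.2 k : R) =
            (fun x => tnth x.2 (Ordinal kN) : R).
    by apply/funext => x; rewrite (tnth_nth 0).
  exact: measurable_b.
have -> : (fun x : entries N => nth 0 x.2 k : R) = cst 0.
  by apply/funext => x; rewrite nth_default// size_tuple.
exact: measurable_cst.
Qed.

Lemma measurable_hermite_mx N (i j : 'I_N) :
  measurable_fun setT (fun x : entries N => hermite_mx x i j).
Proof.
under eq_fun do rewrite mxE.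
case: (i == j); first exact: measurable_a.
case: (j == i.+1 :> nat); first exact: measurable_nth_b.
case: (i == j.+1 :> nat); first exact: measurable_nth_b.
exact: measurable_cst.
Qed.

Lemma measurable_trace_sq N : measurable_fun setT (@trace_sq N).
Proof.
rewrite /trace_sq /mxtrace; apply: measurable_sum => i.
under eq_fun do rewrite mxE.
by apply: measurable_sum => j; apply: measurable_funM;
  exact: measurable_hermite_mx.
Qed.

Lemma measurable_b_positive N : measurable (@b_positive N).
Proof.
have -> : @b_positive N =
    \big[setI/setT]_(j < N.-1) ((fun x => tnth x.2 j : R) @^-1` `]0, +oo[).
  apply/seteqP; split => x; rewrite -bigcap_seq.
    by move=> xp j _ /=; rewrite in_itv/= andbT xp.
  move=> xp j; have := xp j; rewrite /= mem_index_enum.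
  by move=> /(_ isT); rewrite in_itv/= andbT.
apply: bigsetI_measurable => j _.
by rewrite -[X in measurable X]setTI; exact: measurable_b.
Qed.

Lemma measurable_hermite_weight N (beta : R) :
  measurable_fun setT (@hermite_weight N beta).
Proof.
apply: measurable_funM.
  apply: measurableT_comp; first exact: measurable_expR.
  apply: measurableT_comp => //.
  by apply: measurable_funM => //; exact: measurable_trace_sq.
apply: measurable_prod => j _.
by apply: (measurableT_comp (measurable_powR _)); exact: measurable_b.
Qed.

Lemma hermite_weight_ge0 N (beta : R) (x : entries N) :
  0 <= hermite_weight beta x.
Proof.
by rewrite mulr_ge0 ?expR_ge0// prodr_ge0// => j _; exact: powR_ge0.
Qed.

Definition entries_lebesgue N : set (entries N) -> \bar R :=
  (lebesgue_tuple R N \x lebesgue_tuple R N.-1)%E.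
HB.instance Definition _ N := Measure.on (@entries_lebesgue N).

Definition hermite_mass N (beta : R) (A : set (entries N)) : \bar R :=
  (\int[@entries_lebesgue N]_(x in A `&` @b_positive N)
     (hermite_weight beta x)%:E)%E.

Section hermite_mass_measure.
Variables (N : nat) (beta : R).

Let hermite_mass0 : @hermite_mass N beta set0 = 0%E.
Proof. by rewrite /hermite_mass set0I integral_set0. Qed.

Let hermite_mass_ge0 A : (0 <= @hermite_mass N beta A)%E.
Proof. by apply: integral_ge0 => x _; rewrite lee_fin hermite_weight_ge0. Qed.

Let hermite_mass_sigma_additive : semi_sigma_additive (@hermite_mass N beta).
Proof.
move=> F mF tF mUF; rewrite /hermite_mass setI_bigcupl ge0_integral_bigcup//=.
- apply: is_cvg_ereal_nneg_natsum_cond => n _ _.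
  by apply: integral_ge0 => /= x _; rewrite lee_fin hermite_weight_ge0.
- by move=> k; apply: measurableI => //; exact: measurable_b_positive.
- apply/measurable_EFinP; apply: measurable_funTS.
  exact: measurable_hermite_weight.
- by move=> x _; rewrite lee_fin hermite_weight_ge0.
- exact: trivIset_setIr.
Qed.

HB.instance Definition _ := isMeasure.Build _ _ _ (@hermite_mass N beta)
  hermite_mass0 hermite_mass_ge0 hermite_mass_sigma_additive.

End hermite_mass_measure.

(* Dividing by the total mass of hermite_mass is the constant 1 / K.  The Dirac
   measure is the fallback that mnormalize demands for a total mass 0 or +oo; it
   is not reached when 0 < beta. *)
Definition hermite_ensemble N (beta : R) : probability (entries N) R :=
  mnormalize (@hermite_mass N beta)
    (dirac (([tuple 0 | _ < N], [tuple 0 | _ < N.-1]) : entries N)).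

(* Entries of r H / sqrt (tr H^2). *)
Definition rescale N (r : R) (x : entries N) : entries N :=
  let c := r / Num.sqrt (trace_sq x) in
  ([tuple c * (tnth x.1 j : R) | j < N],
   [tuple c * (tnth x.2 j : R) | j < N.-1]).

Lemma measurable_rescale N (r : R) : measurable_fun setT (@rescale N r).
Proof.
have mc : measurable_fun setT (fun x : entries N => r / Num.sqrt (trace_sq x)).
  apply: measurable_funM => //.
  under eq_fun do rewrite -powR_inv1 ?sqrtr_ge0//.
  apply: (measurableT_comp (measurable_powR _)).
  apply: (@measurableT_comp _ _ _ _ _ _ (@Num.sqrt R)) => //.
    exact: (continuous_measurable_fun (@sqrt_continuous R)).
  exact: measurable_trace_sq.
apply: measurable_fun_pair; apply/measurable_fun_tnthP => j.
- under [X in measurable_fun _ X]eq_fun do rewrite /= tnth_mktuple.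
  by apply: measurable_funM => //; exact: measurable_a.
- under [X in measurable_fun _ X]eq_fun do rewrite /= tnth_mktuple.
  by apply: measurable_funM => //; exact: measurable_b.
Qed.

HB.instance Definition _ N (r : R) :=
  isMeasurableFun.Build _ _ _ _ (@rescale N r) (@measurable_rescale N r).

(* The law with formal density proportional to
   delta (tr H^2 / r^2 - 1) * \prod_j b_j `^ (j * beta - 1), realized as the law
   of r H / sqrt (tr H^2) with H in the Hermite ensemble. *)
Definition fixed_trace_ensemble N (beta r : R) : probability (entries N) R :=
  distribution (@hermite_ensemble N beta) (@rescale N r).

(* r > 0 with r^2 = <tr H^2> (= N + beta N (N - 1) / 2). *)
Definition strength N (beta : R) : R :=
  Num.sqrt (fine 'E_(@hermite_ensemble N beta)[@trace_sq N])%E.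

(* Real powers with exponent e >= 0: a negative base needs a natural exponent.
   The guard is needed because the library's powR is not the expected power on
   negative bases. *)
Definition rpow_defined (x e : R) : Prop := 0 <= x \/ e \is a Num.nat.
Definition rpow (x e : R) : R :=
  if e \is a Num.nat then x ^+ Num.truncn e else x `^ e.

Definition monomial N (ea : 'I_N -> R) (eb : 'I_N.-1 -> R) (x : entries N) : R :=
  (\prod_(j < N) rpow (tnth x.1 j) (ea j)) *
  \prod_(j < N.-1) rpow (tnth x.2 j) (eb j).

Definition moment N (P : probability (entries N) R)
    (ea : 'I_N -> R) (eb : 'I_N.-1 -> R) : R :=
  fine ('E_P[monomial ea eb])%E.

(* The monomial makes sense at every matrix of the ensemble and has an
   absolutely convergent expectation. *)
Definition moment_defined N (P : probability (entries N) R)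
    (ea : 'I_N -> R) (eb : 'I_N.-1 -> R) : Prop :=
  (forall x : entries N, b_positive x ->
     (forall j, rpow_defined (tnth x.1 j) (ea j)) /\
     (forall j, rpow_defined (tnth x.2 j) (eb j))) /\
  P.-integrable setT (EFin \o monomial ea eb).

End ensemble.

(* Main.v *)
From HB Require Import structures.
Require Import Defs.
From mathcomp Require Import all_boot all_order all_algebra.
From mathcomp Require Import all_classical all_reals all_analysis.
From mathcomp Require Import measurable_realfun ring.
Import Order.TTheory GRing.Theory Num.Theory.
Import numFieldNormedType.Exports.
Local Open Scope classical_set_scope.
Local Open Scope ring_scope.

Set Implicit Arguments.
Unset Strict Implicit.
Unset Printing Implicit Defensive.

(** Write T = tr H^2, x = (a, b), and let D = N + beta N (N - 1) / 2.  The
    Hermite weight is exp (- T / 2) times a product of powers of the b_j, and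
    against Lebesgue measure that product scales with exponent D under the
    dilations x |-> c x, while T scales with exponent 2.  Hence T and the
    direction x / sqrt T are independent, T / 2 is Gamma distributed with
    parameter D / 2, and r^2 = <T> = D.  A monomial f of degree s satisfies
    f (r x / sqrt T) = r^s f(x) T^(- s / 2), so independence gives
      M_r / M = D^(s / 2) / <T^(s / 2)>,
    whatever the exponents eta, and it remains to see that the T^(s / 2)
    moment of the variable T / D, of mean 1 and variance 2 / D, tends to 1.

    Independence is obtained without polar coordinates.  Let I(h) be the
    integral of h against the Hermite weight (hermite_int).  If h >= 0 is
    homogeneous of degree d, the dilation by sqrt (1 + l) gives
      I(h exp (- l T / 2)) = (1 + l)^(- (D + d) / 2) I(h)
    (hermite_int_expR).  Integrating against l^a dl over l > 0 and exchanging
    the integrals turns this into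
      I(h T^(- (a + 1))) * gamma_int a = I(h) * beta_int a ((D + d) / 2)
    (hermite_int_mellin), where h enters the constants only through its
    degree.  For a = 0 both constants are explicit and
    I(h T) = (D + d) I(h) (hermite_int_trace_sq): this yields <T> = D and
    <T^k> = D (D + 2) ... (D + 2 k - 2).  For a = s / 2, comparing h with
    T^(s / 2) gives the factorization
      I(h T^(- s / 2)) I(T^(s / 2)) = I(h) I(1)
    (hermite_int_factor); signed monomials follow from their positive and
    negative parts (integral_fixed_trace).

    For the limit, put y = T / D and p = s / 2, and take an integer k >= p.
    Since y^p lies between 1 and y^k, |y^p - 1| <= |y^k - 1|, and
    <|y^k - 1|> is controlled by <(y^k - 1)^2>, that is by integer moments of
    y; these are products of factors 1 + 2 i / D, and D tends to infinity
    (trace_powR_bound, cvg_trace_moment).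

    The factorization divides by the total mass of the weight.  Were that mass
    0 or infinite, the normalized law would be a Dirac mass at the zero matrix,
    where a nonzero moment forces the monomial to be constant, so that the
    ratio is 1 (moment_ratio_degenerate).  This case distinction replaces the
    evaluation of the normalization constant. *)

(** * Scaling, densities and Tonelli on subsets *)

Section integration.
Context {R : realType}.
Notation RT := (measurableTypeR R).

(** Both sides define measures of the Borel sets, so it is enough that
    c * mu (A / c) agrees with mu A on half-open intervals. *)
Lemma ge0_integral_scale (c : R) (f : RT -> \bar R) :
  0 < c -> measurable_fun setT f -> (forall x, 0 <= f x)%E ->
  (\int[lebesgue_measure]_x f x =
   c%:E * \int[lebesgue_measure]_x f (c * x)%R)%E.
Proof.
move=> c0 mf f0.
have mc : measurable_fun setT ( *%R c : RT -> RT) by exact: mulrl_measurable.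
pose scaled : {measure set RT -> \bar R} :=
  mscale (NngNum (ltW c0)) (@pushforward _ _ RT RT R lebesgue_measure ( *%R c)).
pose m := scaled mc.
transitivity (\int[m]_x f x)%E.
  apply: eq_measure_integral => A mA _.
  apply: lebesgue_measure_unique => // _ [[a b] _ <-] /=.
  rewrite /mscale/= /pushforward.
  have -> : ( *%R c) @^-1` `]a, b] = `](a / c), (b / c)]%classic.
    by apply/seteqP; split => x /=; rewrite !in_itv/= ltr_pdivrMr// ler_pdivlMr// mulrC.
  rewrite !lebesgue_measure_itv/= !lte_fin ltr_pM2r ?invr_gt0//.
  case: ifPn => _; last by rewrite mule0.
  by rewrite -!EFinB -EFinM -mulrBl mulrCA divff ?mulr1// gt_eqF.
rewrite ge0_integral_mscale//; congr (_ * _)%E.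
by rewrite ge0_integral_pushforward.
Qed.

Import HBNNSimple.

(** Turns a measure known only through its values on sets into an integral
    against mu; it is what links the ensemble to Lebesgue integrals.  The
    identity is linear in f and holds for indicators, hence for simple
    functions, and passes to their increasing limits. *)
Lemma ge0_integral_density d (T : measurableType d) (mu nu : {measure set T -> \bar R})
    (B : set T) (w : T -> R) (f : T -> \bar R) :
  measurable B -> measurable_fun setT w -> (forall x, 0 <= w x) ->
  (forall A, measurable A -> nu A = \int[mu]_(x in A `&` B) (w x)%:E)%E ->
  measurable_fun setT f -> (forall x, 0 <= f x)%E ->
  (\int[nu]_x f x = \int[mu]_(x in B) (f x * (w x)%:E))%E.
Proof.
move=> mB mw w0 nuE mf f0; pose f_ := nnsfun_approx measurableT mf.
have mwB D : measurable_fun D (EFin \o w) by apply/measurable_EFinP; exact: measurable_funTS.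
transitivity (limn (fun n => \int[nu]_x (f_ n x)%:E))%E.
  rewrite -monotone_convergence//=.
  - by apply: eq_integral => x _; apply/esym/cvg_lim => //; exact: cvg_nnsfun_approx.
  - by move=> n; exact/measurable_EFinP/measurable_funTS.
  - by move=> n x _; rewrite lee_fin.
  - by move=> x _ a b ab; rewrite lee_fin; exact/lefP/nd_nnsfun_approx.
transitivity (limn (fun n => \int[mu]_(x in B) ((f_ n x)%:E * (w x)%:E)))%E; last first.
  rewrite -monotone_convergence//=.
  - apply: eq_integral => x _; apply/cvg_lim => //.
    apply: cvgeZr => //; exact: cvg_nnsfun_approx.
  - by move=> n; apply: emeasurable_funM => //; exact/measurable_EFinP/measurable_funTS.
  - by move=> n x _; rewrite -EFinM lee_fin mulr_ge0.
  - move=> x _ a b ab; rewrite -!EFinM lee_fin ler_wpM2r//.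
    exact/lefP/nd_nnsfun_approx.
apply: congr_lim; apply/funext => n /=.
under eq_integral do rewrite fimfunE -fsumEFin//.
rewrite ge0_integral_fsum//; last 2 first.
- by move=> y; exact/measurable_EFinP/measurable_funM.
- by move=> y x _; rewrite nnfun_muleindic_ge0.
under [RHS]eq_integral.
  move=> x _; rewrite fimfunE -fsumEFin// ge0_mule_fsuml; last first.
    by move=> y; rewrite nnfun_muleindic_ge0.
  over.
rewrite [RHS]ge0_integral_fsum//; last 2 first.
- move=> y; apply: emeasurable_funM => //.
  by apply: measurable_funTS; exact/measurable_EFinP/measurable_funM.
- move=> y x _; rewrite mule_ge0 ?lee_fin// -lee_fin EFinM.
  by rewrite nnfun_muleindic_ge0.
apply: eq_fsbigr => y _; rewrite integralZl_indic_nnsfun//.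
rewrite integral_indic// setIT.
have mfy : measurable (f_ n @^-1` [set y]) by [].
have [->|yf] := eqVneq (f_ n @^-1` [set y]) set0.
  rewrite measure0 mule0; apply/esym; apply: integral0_eq => x _.
  by rewrite indic0 mulr0 mul0e.
have y0 : 0 <= y by have /set0P[x <-] := yf; exact: fun_ge0.
under [RHS]eq_integral do rewrite EFinM -muleA.
rewrite ge0_integralZl//; last 2 first.
- apply: emeasurable_funM => //.
  by apply: measurable_funTS; exact/measurable_EFinP.
- by move=> x _; rewrite mule_ge0// lee_fin.
congr (_ * _)%E; rewrite nuE// setIC integral_mkcondr.
by apply: eq_integral => x _; rewrite patchE indicE; case: ifPn; rewrite ?mul1e ?mul0e.
Qed.

Lemma fubini_tonelli_on d1 d2 (T1 : measurableType d1) (T2 : measurableType d2)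
    (m1 : {sigma_finite_measure set T1 -> \bar R})
    (m2 : {sigma_finite_measure set T2 -> \bar R})
    (A : set T1) (B : set T2) (f : T1 * T2 -> \bar R) :
  measurable A -> measurable B -> measurable_fun setT f ->
  (forall z, 0 <= f z)%E ->
  (\int[m1]_(x in A) \int[m2]_(y in B) f (x, y) =
   \int[m2]_(y in B) \int[m1]_(x in A) f (x, y))%E.
Proof.
move=> mA mB mf f0; rewrite integral_mkcond [RHS]integral_mkcond.
have fE : forall x y, ((f \_ (A `*` B)) (x, y) =
    if x \in A then if y \in B then f (x, y) else 0 else 0)%E.
  by move=> x y; rewrite patchE in_setX/=; case: (x \in A); case: (y \in B).
have mg : measurable_fun setT (f \_ (A `*` B)).
  by apply/(measurable_restrict _ (measurableX mA mB) measurableT); exact: measurable_funTS.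
transitivity (\int[m1]_x \int[m2]_y (f \_ (A `*` B)) (x, y))%E.
  apply: eq_integral => x _; rewrite patchE.
  under [RHS]eq_integral do rewrite fE.
  case: ifPn => _; last by rewrite integral0.
  by rewrite [LHS]integral_mkcond; apply: eq_integral => y _; rewrite patchE.
rewrite fubini_tonelli//; last by move=> z; rewrite patchE; case: ifPn.
apply: eq_integral => y _; rewrite patchE.
under eq_integral do rewrite fE.
case: ifPn => _.
  by rewrite [RHS]integral_mkcond; apply: eq_integral => x _; rewrite patchE.
by apply: integral0_eq => x _; case: ifPn.
Qed.
End integration.

(** * Dilations of Lebesgue measure on tuples *)

Section dilation.
Context {R : realType}.
Notation RT := (measurableTypeR R).
Local Notation entries N := (N.-tuple RT * N.-1.-tuple RT)%type.

Definition tscale n (c : R) (t : n.-tuple RT) : n.-tuple RT :=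
  [tuple c * (tnth t j : R) | j < n].

Definition dilate N (c : R) (x : entries N) : entries N :=
  (tscale c x.1, tscale c x.2).

Lemma measurable_tscale n (c : R) : measurable_fun setT (@tscale n c).
Proof.
apply/measurable_fun_tnthP => j.
under [X in measurable_fun _ X]eq_fun do rewrite /= tnth_mktuple.
by apply: measurable_funM => //; exact: measurable_tnth.
Qed.

Lemma measurable_dilate N (c : R) : measurable_fun setT (@dilate N c).
Proof.
by apply: measurable_fun_pair;
  apply: measurableT_comp => //; exact: measurable_tscale.
Qed.

Lemma tscale_tcons n (c : R) (x : RT) (t : n.-tuple RT) :
  tscale c (tcons (x, t)) = tcons (c * x : RT, tscale c t).
Proof.
apply: eq_from_tnth => j; rewrite tnth_mktuple; case: (unliftP ord0 j) => [k|] ->.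
  by rewrite !tnthS tnth_mktuple.
by rewrite !tnth0.
Qed.

(** Induction on the dimension: each coordinate contributes one factor c. *)
Lemma ge0_integral_tscale n (c : R) (f : n.-tuple RT -> \bar R) :
  0 < c -> measurable_fun setT f -> (forall t, 0 <= f t)%E ->
  (\int[lebesgue_tuple R n]_t f t =
   (c ^+ n)%:E * \int[lebesgue_tuple R n]_t f (tscale c t))%E.
Proof.
move=> c0; elim: n f => [|n IH] f mf f0.
  rewrite expr0 mul1e; apply: eq_integral => t _.
  by congr f; rewrite [RHS]tuple0 [LHS]tuple0.
have mft : measurable_fun setT (f \o @tcons R n).
  by apply: measurableT_comp => //; exact: measurable_tcons.
have step (g : n.+1.-tuple RT -> \bar R) :
    measurable_fun setT g -> (forall t, 0 <= g t)%E ->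
    (\int[lebesgue_tuple R n.+1]_t g t =
     \int[lebesgue_measure]_x \int[lebesgue_tuple R n]_t g (tcons (x, t)))%E.
  move=> mg g0.
  transitivity (\int[(lebesgue_measure \x lebesgue_tuple R n)%E]_z g (tcons z))%E.
    by rewrite -(@ge0_integral_pushforward _ _ _ _ _ _ (@measurable_tcons R n)
      (lebesgue_measure \x lebesgue_tuple R n)%E setT).
  rewrite (fubini_tonelli1 (g \o @tcons R n))//; last by move=> z; exact: g0.
  by apply: measurableT_comp => //; exact: measurable_tcons.
have mfc := measurableT_comp mf (@measurable_tscale n.+1 c).
rewrite step// [in RHS]step//.
have mtc := measurableT_comp mfc (@measurable_tcons R n).
transitivity (\int[lebesgue_measure]_x
    ((c ^+ n)%:E * \int[lebesgue_tuple R n]_t f (tcons (x, tscale c t))))%E.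
  apply: eq_integral => x _; rewrite (IH (fun t => f (tcons (x, t))))//.
  by apply: measurableT_comp mft _; exact: measurable_pair1.
have mfx : measurable_fun setT (fun z : RT * n.-tuple RT => f (tcons (z.1, tscale c z.2))).
  apply: (measurableT_comp mft); apply: measurable_fun_pair => //.
  by apply: measurableT_comp => //; exact: measurable_tscale.
have mF : measurable_fun setT
    (fun x : RT => \int[lebesgue_tuple R n]_t f (tcons (x, tscale c t)))%E.
  exact: (measurable_fun_fubini_tonelli_F (fun z : RT * n.-tuple RT => f (tcons (z.1, tscale c z.2)))).
rewrite (@ge0_integralZl _ _ _ _ _ measurableT _ mF); last 2 first.
- by move=> x _; exact: integral_ge0.
- by rewrite lee_fin exprn_ge0// ltW.
rewrite (ge0_integral_scale c0 mF); last by move=> x; exact: integral_ge0.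
rewrite muleA -EFinM -exprSr; congr (_ * _)%E.
by apply: eq_integral => x _; apply: eq_integral => t _; rewrite tscale_tcons.
Qed.

Lemma ge0_integral_dilate N (c : R) (f : entries N -> \bar R) :
  0 < c -> measurable_fun setT f -> (forall x, 0 <= f x)%E ->
  (\int[@entries_lebesgue R N]_x f x =
   (c ^+ (N + N.-1))%:E * \int[@entries_lebesgue R N]_x f (dilate c x))%E.
Proof.
move=> c0 mf f0; rewrite /entries_lebesgue fubini_tonelli1//.
have mfd := measurableT_comp mf (@measurable_dilate N c).
rewrite (fubini_tonelli1 (f \o @dilate N c))//; last by move=> z; exact: f0.
transitivity (\int[lebesgue_tuple R N]_s
    ((c ^+ N.-1)%:E * \int[lebesgue_tuple R N.-1]_t f (s, tscale c t)))%E.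
  apply: eq_integral => s _; rewrite /fubini_F (ge0_integral_tscale c0 (f := fun t => f (s, t)))//.
  by apply: measurableT_comp mf _; exact: measurable_pair1.
have mF : measurable_fun setT
    (fun s => \int[lebesgue_tuple R N.-1]_t f (s, tscale c t))%E.
  apply: (measurable_fun_fubini_tonelli_F (fun z : entries N => f (z.1, tscale c z.2))) => //.
  apply: (measurableT_comp mf); apply: measurable_fun_pair => //.
  by apply: measurableT_comp => //; exact: measurable_tscale.
rewrite (@ge0_integralZl _ _ _ _ _ measurableT _ mF); last 2 first.
- by move=> x _; exact: integral_ge0.
- by rewrite lee_fin exprn_ge0// ltW.
rewrite (ge0_integral_tscale c0 mF); last by move=> x; exact: integral_ge0.
by rewrite muleA -EFinM -exprD addnC.
Qed.
End dilation.

(** * Homogeneity of the Hermite weight *)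

Section homogeneity.
Context {R : realType}.
Notation RT := (measurableTypeR R).
Local Notation entries N := (N.-tuple RT * N.-1.-tuple RT)%type.

Lemma nth_tscale n (c : R) (t : n.-tuple RT) k :
  nth 0 (tscale c t) k = c * (nth 0 t k : R).
Proof.
have [kn|nk] := ltnP k n; last by rewrite !nth_default ?size_tuple ?mulr0.
by rewrite -(tnth_nth 0 _ (Ordinal kn)) tnth_mktuple (tnth_nth 0).
Qed.

Lemma hermite_mx_dilate N (c : R) (x : entries N) :
  hermite_mx (dilate c x) = c *: hermite_mx x.
Proof.
apply/matrixP => i j; rewrite !mxE /= !nth_tscale tnth_mktuple.
by do 3![case: ifPn => _ //]; rewrite mulr0.
Qed.

Lemma trace_sq_dilate N (c : R) (x : entries N) :
  trace_sq (dilate c x) = c ^+ 2 * trace_sq x.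
Proof.
by rewrite /trace_sq hermite_mx_dilate -scalemxAl -scalemxAr !mxtraceZ expr2 mulrA.
Qed.

Lemma trace_sqE N (x : entries N) :
  trace_sq x = \sum_(i < N) \sum_(j < N) hermite_mx x i j ^+ 2.
Proof.
apply: eq_bigr => i _; rewrite mxE; apply: eq_bigr => j _; rewrite expr2.
congr (_ * _); rewrite !mxE eq_sym; case: eqP => [->//|_].
case: ifPn => [/eqP ij|_]; last by case: ifPn.
by rewrite ij (@ltn_eqF j).
Qed.

Lemma trace_sq_ge0 N (x : entries N) : 0 <= trace_sq x.
Proof. by rewrite trace_sqE; do 2! [apply: sumr_ge0 => ? _]; exact: sqr_ge0. Qed.

Lemma trace_sq_gt0 N (x : entries N) :
  (2 <= N)%N -> b_positive x -> 0 < trace_sq x.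
Proof.
case: N x => [|[|N]]// x _ xpos; rewrite lt_neqAle trace_sq_ge0 andbT eq_sym.
rewrite trace_sqE psumr_neq0; last by move=> i _; apply: sumr_ge0 => j _; exact: sqr_ge0.
apply/hasP; exists ord0; rewrite ?mem_index_enum//=.
rewrite lt_neqAle sumr_ge0 ?andbT; last by move=> j _; exact: sqr_ge0.
rewrite eq_sym psumr_neq0; last by move=> j _; exact: sqr_ge0.
apply/hasP; exists (lift ord0 ord0); rewrite ?mem_index_enum//=.
rewrite exprn_even_gt0//= mxE/= subSS subn1/=.
by rewrite -(tnth_nth 0 _ (Ordinal (ltnSn N))) gt_eqF.
Qed.

Lemma b_positive_dilate N (c : R) (x : entries N) : 0 < c ->
  (dilate c x \in @b_positive R N) = (x \in @b_positive R N).
Proof.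
move=> c0; apply/idP/idP => /set_mem xpos; apply/mem_set => j.
  by have := xpos j; rewrite tnth_mktuple pmulr_rgt0.
by rewrite tnth_mktuple mulr_gt0//; exact: xpos.
Qed.

(** The homogeneity degree of the weight without its exponential factor,
    counting the 2 N - 1 dimensions of Lebesgue measure: the latter cancel
    against the exponents -1 of the b_j, which leaves N + beta (1 + ... + (N - 1)).
    It is also the expectation of [trace_sq]. *)
Definition hermite_dim N (beta : R) : R :=
  N%:R + beta * \sum_(j < N.-1) j.+1%:R.

Lemma hermite_dim_ge N (beta : R) : 0 <= beta -> N%:R <= hermite_dim N beta.
Proof. by move=> b0; rewrite lerDl mulr_ge0// sumr_ge0. Qed.

Lemma hermite_dim_gt0 N (beta : R) : (0 < N)%N -> 0 <= beta -> 0 < hermite_dim N beta.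
Proof. by move=> N0 b0; rewrite (lt_le_trans _ (hermite_dim_ge N b0))// ltr0n. Qed.

Lemma prod_powR (I : finType) (c : R) (e : I -> R) : 0 < c ->
  \prod_i c `^ e i = c `^ (\sum_i e i).
Proof.
move=> c0; apply/esym; apply: (big_morph (fun u => c `^ u)) => [u v|].
  by rewrite powRD// (gt_eqF c0) implybT.
by rewrite powRr0.
Qed.

(** The exponential factor is written relative to its value at x, so that a
    dilation acts on the weight as a power of c times a Gaussian tilt. *)
Lemma hermite_weight_dilate N (beta c : R) (x : entries N) :
  0 < c -> b_positive x ->
  hermite_weight beta (dilate c x) =
  c `^ (hermite_dim N beta - (N + N.-1)%:R) *
  (expR (- ((c ^+ 2 - 1) * (trace_sq x / 2))) * hermite_weight beta x).
Proof.
move=> c0 xpos; rewrite /hermite_weight trace_sq_dilate.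
have -> : - (c ^+ 2 * trace_sq x / 2) =
    - ((c ^+ 2 - 1) * (trace_sq x / 2)) + - (trace_sq x / 2) by ring.
rewrite expRD.
under eq_bigr => j _.
  rewrite tnth_mktuple powRM; [|exact: ltW|exact: ltW (xpos j)].
  over.
rewrite big_split/= prod_powR//.
have -> : \sum_(j < N.-1) (j.+1%:R * beta - 1) =
    hermite_dim N beta - (N + N.-1)%:R.
  rewrite sumrB -mulr_suml sumr_const card_ord /hermite_dim natrD; ring.
ring.
Qed.

(** Restricted to positive b_j: outside that domain neither the weight nor
    real powers of the b_j are homogeneous. *)
Definition homogeneous N (d : R) (h : entries N -> R) :=
  forall c x, 0 < c -> b_positive x -> h (dilate c x) = c `^ d * h x.

Definition hermite_int N (beta : R) (h : entries N -> R) : \bar R :=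
  (\int[@entries_lebesgue R N]_(x in @b_positive R N)
    (h x * hermite_weight beta x)%:E)%E.

Lemma eq_hermite_int N (beta : R) (h1 h2 : entries N -> R) :
  (forall x, b_positive x -> h1 x = h2 x) ->
  hermite_int beta h1 = hermite_int beta h2.
Proof. by move=> h12; apply: eq_integral => x /set_mem xpos; rewrite h12. Qed.

Lemma hermite_int_ge0 N (beta : R) (h : entries N -> R) :
  (forall x, 0 <= h x) -> (0 <= hermite_int beta h)%E.
Proof.
by move=> h0; apply: integral_ge0 => x _; rewrite lee_fin mulr_ge0// hermite_weight_ge0.
Qed.

Lemma measurable_hermite_int N (beta : R) D (h : entries N -> R) :
  measurable_fun setT h -> measurable_fun D (fun x => (h x * hermite_weight beta x)%:E).
Proof.
move=> mh; apply: measurable_funTS; apply/measurable_EFinP.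
by apply: measurable_funM => //; exact: measurable_hermite_weight.
Qed.

(** Change variables by the dilation of factor c = (1 + l)^(1/2): it maps the
    Gaussian factor to itself times exp (- l T / 2), and everything else is
    homogeneous. *)
Lemma hermite_int_expR N (beta d l : R) (h : entries N -> R) :
  0 <= l -> measurable_fun setT h -> (forall x, 0 <= h x) -> homogeneous d h ->
  (hermite_int beta (fun x => expR (- (l * (trace_sq x / 2))) * h x)%R =
   ((1 + l) `^ (- ((hermite_dim N beta + d) / 2)))%:E * hermite_int beta h)%E.
Proof.
move=> l0 mh h0 hd; set E := fun x => _.
have l1 : 0 < 1 + l by rewrite ltr_wpDr.
set c := (1 + l) `^ 2^-1; have c0 : 0 < c by exact: powR_gt0.
have c2 : c ^+ 2 - 1 = l.
  by rewrite -powR_mulrn ?ltW// -powRrM mulVf ?pnatr_eq0// powRr1 ?ltW// addrC addKr.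
have mB := @measurable_b_positive R N.
have E0 x : 0 <= E x by apply: mulr_ge0 (h0 x); exact: expR_ge0.
have mE : measurable_fun setT E.
  apply: measurable_funM => //.
  apply: measurableT_comp => //; apply: measurableT_comp => //.
  apply: measurable_funM => //; apply: measurable_funM => //.
  exact: measurable_trace_sq.
have hE : (hermite_int beta h =
    (c `^ (hermite_dim N beta + d))%:E * hermite_int beta E)%E.
  rewrite {1}/hermite_int integral_mkcond (ge0_integral_dilate c0)//; last 2 first.
  - apply/(measurable_restrict _ mB measurableT); rewrite setTI.
    exact: measurable_hermite_int.
  - by move=> x; rewrite patchE; case: ifPn => // _; rewrite lee_fin mulr_ge0// hermite_weight_ge0.
  transitivity ((c ^+ (N + N.-1))%:E *
    \int[@entries_lebesgue R N]_(x in @b_positive R N)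
      ((c `^ (hermite_dim N beta - (N + N.-1)%:R + d))%:E *
        (E x * hermite_weight beta x)%:E))%E.
    congr (_ * _)%E; rewrite [RHS]integral_mkcond; apply: eq_integral => x _.
    rewrite !patchE b_positive_dilate//; case: ifPn => // /set_mem xpos.
    rewrite hd// hermite_weight_dilate// c2 -EFinM; congr EFin.
    by rewrite [c `^ (_ - _ + d)]powRD ?(gt_eqF c0) ?implybT// /E; ring.
  rewrite (@ge0_integralZl _ _ _ _ _ mB _ (measurable_hermite_int beta mE)); last 2 first.
  - by move=> x _; rewrite lee_fin; apply: mulr_ge0 (E0 x) (hermite_weight_ge0 _ _).
  - by rewrite lee_fin powR_ge0.
  rewrite muleA -EFinM -powR_mulrn ?ltW// -powRD ?(gt_eqF c0) ?implybT//.
  by congr ((_ `^ _)%:E * _)%E; ring.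
rewrite hE muleA -EFinM /c -powRrM -powRD ?(gt_eqF l1) ?implybT//.
by rewrite mulrC addNr powRr0 mul1e.
Qed.
End homogeneity.

(** * The Mellin transform of the dilation identity *)

(** Tonelli's theorem on entries and the half-line requires both measures to
    be sigma-finite. *)
Section sigma_finite.
Variable R : realType.

Let sigma_finite_entries_lebesgue N : sigma_finite setT (@entries_lebesgue R N).
Proof.
have /sigma_finiteP[F [TF ndF Foo]] := sigma_finiteT (lebesgue_tuple R N).
have /sigma_finiteP[G [TG ndG Goo]] := sigma_finiteT (lebesgue_tuple R N.-1).
exists (fun k => F k `*` G k) => [|k].
  apply/esym/seteqP; split=> // -[s t] _.
  have [[i _ Fi] [j _ Gj]] : (\bigcup_k F k) s /\ (\bigcup_k G k) t by rewrite -TF -TG.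
  exists (maxn i j) => //; split.
  - exact: (subsetPset _ _ (ndF _ _ (leq_maxl i j))).
  - exact: (subsetPset _ _ (ndG _ _ (leq_maxr i j))).
have [mF Fk] := Foo k; have [mG Gk] := Goo k.
split; first exact: measurableX.
rewrite /entries_lebesgue product_measure1E//.
by rewrite lte_mul_pinfty// ge0_fin_numE.
Qed.

HB.instance Definition _ N := Measure_isSigmaFinite.Build _ _ _ (@entries_lebesgue R N)
  (sigma_finite_entries_lebesgue N).

End sigma_finite.

Section mellin.
Context {R : realType}.
Notation mu := (@lebesgue_measure R).

(** gamma_int a is 2^(a + 1) Gamma(a + 1), and beta_int a q is the beta
    function B(a + 1, q - a - 1).  Only the values at a = 0 are computed; for
    the other ones positivity or finiteness is enough. *)
Definition gamma_int (a : R) : \bar R :=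
  (\int[mu]_(l in `]0%R, +oo[) (l `^ a * expR (- (l / 2)))%:E)%E.

Definition beta_int (a q : R) : \bar R :=
  (\int[mu]_(l in `]0%R, +oo[) (l `^ a * (1 + l) `^ (- q))%:E)%E.

Lemma integral_FTC_0y (f F : R -> R) (y : R) :
  (forall x : R, 0 <= x -> 0 <= f x) ->
  (forall x : R, 0 <= x -> {for x, continuous f}) ->
  (forall x : R, 0 <= x -> is_derive x 1 F (f x)) ->
  F x @[x --> +oo] --> y ->
  (\int[mu]_(x in `]0%R, +oo[) (f x)%:E = (y - F 0)%:E)%E.
Proof.
move=> f0 cf dF Fy.
rewrite integral_itv_obnd_cbnd; last first.
  apply/measurable_EFinP; apply: open_continuous_measurable_fun => //.
  by move=> x; rewrite inE/= in_itv/= andbT => x0; exact/cf/ltW.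
rewrite (@ge0_continuous_FTC2y _ f F 0 y)//.
- apply/continuous_within_itvcyP; split.
    by move=> x; rewrite in_itv/= andbT => x0; exact/cf/ltW.
  by apply: cvg_at_right_filter; exact: cf.
- by move=> x x0; have [] := dF x (ltW x0).
- apply: cvg_at_right_filter; apply: differentiable_continuous.
  by apply/derivable1_diffP; have [] := dF 0 (lexx 0).
- move=> x; rewrite in_itv/= andbT => x0.
  by rewrite derive1E; have [] := dF x (ltW x0).
Qed.

Lemma gamma_int0 : gamma_int 0 = 2%:E.
Proof.
rewrite /gamma_int.
under eq_integral do rewrite powRr0 mul1r.
have dexp (x : R) : is_derive x 1 (fun l : R => expR (- (l / 2))) (- (expR (- (x / 2)) / 2)).
  have dg : is_derive x 1 (fun l : R => - (l / 2)) (- (1 / 2)).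
    apply: is_deriveN; under eq_fun do rewrite mulrC.
    by rewrite mul1r -[X in is_derive _ _ _ X]mulr1; apply: is_deriveZ.
  have := @is_derive1_comp _ expR (fun l : R => - (l / 2)) x _ _ (is_derive_expR (- (x / 2))) dg.
  by move=> /is_derive_eq; apply; rewrite mul1r mulrN.
pose F (l : R) : R := - 2 * expR (- (l / 2)).
have cf (x : R) : 0 <= x -> {for x, continuous (fun l : R => expR (- (l / 2)))}.
  move=> _; apply: differentiable_continuous; apply/derivable1_diffP.
  by have [] := dexp x.
have dF (x : R) : 0 <= x -> is_derive x 1 F (expR (- (x / 2))).
  move=> _; have := @is_deriveZ _ _ _ _ (- 2) _ _ _ (dexp x).
  by move=> /is_derive_eq; apply; rewrite /GRing.scale/= mulrNN mulrCA divff ?mulr1.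
have Fy : F x @[x --> +oo] --> (0 : R).
  rewrite -(mulr0 (- 2)); apply: cvgMr.
  apply: (@cvg_comp _ _ _ (fun l : R => l / 2) (fun l => expR (- l)) _ (pinfty_nbhs R)); last exact: cvgr_expR.
  by apply: gt0_cvgMly.
rewrite (integral_FTC_0y (fun x _ => expR_ge0 _) cf dF Fy).
by rewrite /F mul0r oppr0 expR0 mulr1 sub0r opprK.
Qed.

Lemma beta_int0 (q : R) : 1 < q -> beta_int 0 q = (q - 1)^-1%:E.
Proof.
move=> q1; have q10 : 0 < q - 1 by rewrite subr_gt0.
rewrite /beta_int.
under eq_integral do rewrite powRr0 mul1r.
have dpow (e x : R) : 0 <= x ->
    is_derive x 1 (fun l : R => (1 + l) `^ e) (e * (1 + x) `^ (e - 1)).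
  move=> x0; have x1 : 0 < 1 + x by rewrite ltr_wpDr.
  have dg : is_derive x 1 (fun l : R => 1 + l) 1.
    by rewrite -[X in is_derive _ _ _ X]add0r; apply: is_deriveD.
  have := @is_derive1_comp _ (fun l : R => l `^ e) (fun l : R => 1 + l) x _ _ (is_derive1_powR e x1) dg.
  by move=> /is_derive_eq; apply; rewrite mulr1.
pose F (l : R) : R := - (q - 1)^-1 * (1 + l) `^ (1 - q).
have cf (x : R) : 0 <= x -> {for x, continuous (fun l : R => (1 + l) `^ (- q))}.
  move=> x0; apply: differentiable_continuous; apply/derivable1_diffP.
  by have [] := dpow (- q) x x0.
have dF (x : R) : 0 <= x -> is_derive x 1 F ((1 + x) `^ (- q)).
  move=> x0; have := @is_deriveZ _ _ _ _ (- (q - 1)^-1) _ _ _ (dpow (1 - q) x x0).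
  move=> /is_derive_eq; apply.
  rewrite /GRing.scale/= addrAC subrr add0r mulrA -(opprB q 1) mulrNN mulVf ?mul1r//.
  exact: lt0r_neq0.
have Fy : F x @[x --> +oo] --> (0 : R).
  rewrite -(mulr0 (- (q - 1)^-1)); apply: cvgMr.
  apply/cvgrPdist_lt => e e0; near=> l.
  have l1 : 0 <= 1 + l by rewrite addr_ge0.
  rewrite sub0r normrN ger0_norm ?powR_ge0// -(opprB q 1) powRN.
  rewrite -[e]invrK ltf_pV2 ?posrE ?invr_gt0 ?powR_gt0//; last first.
    by rewrite ltr_wpDr.
  rewrite -[ltLHS]powRr1 ?invr_ge0 ?ltW// -[X in _ `^ X](mulVf (lt0r_neq0 q10)) powRrM.
  rewrite gt0_ltr_powR ?nnegrE ?powR_ge0//.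
  by apply: lt_trans (_ : l < _); [near: l; exact: nbhs_pinfty_gt | rewrite ltrDr].
rewrite (integral_FTC_0y (fun x _ => powR_ge0 _ _) cf dF Fy).
by rewrite /F addr0 powR1 mulr1 sub0r opprK.
Unshelve. all: by end_near. Qed.

Lemma gamma_int_scale (a t : R) : 0 < t ->
  (\int[mu]_(l in `]0%R, +oo[) (l `^ a * expR (- (l * (t / 2))))%:E =
   (t `^ (- (a + 1)))%:E * gamma_int a)%E.
Proof.
move=> t0; pose f (l : R) := (l `^ a * expR (- (l / 2)))%:E.
have mJ : measurable (`]0%R, +oo[%classic : set (measurableTypeR R)) by [].
have mf : measurable_fun setT f.
  apply/measurable_EFinP; apply: measurable_funM; first exact: measurable_powR.
  apply: measurableT_comp => //; apply: measurableT_comp => //.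
  exact: measurable_funM.
have mg : measurable_fun setT (fun l : R => (l `^ a * expR (- (l * (t / 2))))%:E).
  apply/measurable_EFinP; apply: measurable_funM; first exact: measurable_powR.
  apply: measurableT_comp => //; apply: measurableT_comp => //.
  exact: measurable_funM.
have -> : (gamma_int a = (t `^ (a + 1))%:E *
    \int[mu]_(l in `]0%R, +oo[) (l `^ a * expR (- (l * (t / 2))))%:E)%E.
  rewrite /gamma_int integral_mkcond (ge0_integral_scale t0); last 2 first.
  - by apply/(measurable_restrict _ mJ measurableT); exact: measurable_funTS mf.
  - by move=> x; rewrite patchE; case: ifPn => // _; rewrite lee_fin mulr_ge0 ?powR_ge0 ?expR_ge0.
  transitivity (t%:E * \int[mu]_(l in `]0%R, +oo[)
      ((t `^ a)%:E * (l `^ a * expR (- (l * (t / 2))))%:E))%E.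
    congr (_ * _)%E; rewrite [RHS]integral_mkcond; apply: eq_integral => l _.
    rewrite !patchE !mem_setE !in_itv/= !andbT pmulr_rgt0//.
    case: ifPn => // l0; rewrite -EFinM; congr EFin.
    have -> : t * l / 2 = l * (t / 2) by ring.
    by rewrite powRM ?ltW// -mulrA.
  rewrite (@ge0_integralZl _ _ _ _ _ mJ _ (measurable_funTS mg)); last 2 first.
  - by move=> l _; rewrite lee_fin mulr_ge0 ?powR_ge0 ?expR_ge0.
  - by rewrite lee_fin powR_ge0.
  rewrite muleA -EFinM powRD ?(gt_eqF t0) ?implybT// powRr1 ?ltW//.
  by rewrite (mulrC t (t `^ a)).
rewrite muleA -EFinM -powRD ?(gt_eqF t0) ?implybT//.
by rewrite addNr powRr0 mul1e.
Qed.

Notation RT := (measurableTypeR R).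
Local Notation entries N := (N.-tuple RT * N.-1.-tuple RT)%type.

(** Evaluate the double integral of
    l^a exp (- l T(x) / 2) h(x) w(x) in both orders: the integral over l is a
    gamma integral rescaled by T(x), and the integral over x is given by
    [hermite_int_expR]. *)
Lemma hermite_int_mellin N (beta d a : R) (h : entries N -> R) :
  (2 <= N)%N -> measurable_fun setT h -> (forall x, 0 <= h x) ->
  homogeneous d h ->
  (hermite_int beta (fun x => h x * trace_sq x `^ (- (a + 1)))%R * gamma_int a =
   hermite_int beta h * beta_int a ((hermite_dim N beta + d) / 2))%E.
Proof.
move=> N2 mh h0 hd.
have mJ : measurable (`]0%R, +oo[%classic : set RT) by [].
have mB := @measurable_b_positive R N.
have mT := @measurable_trace_sq R N.
have mw := @measurable_hermite_weight R N beta.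
pose f (z : entries N * RT) : \bar R :=
  (z.2 `^ a * (expR (- (z.2 * (trace_sq z.1 / 2))) * h z.1 * hermite_weight beta z.1))%:E.
have mf : measurable_fun setT f.
  apply/measurable_EFinP; apply: measurable_funM.
    exact: measurableT_comp (measurable_powR a) measurable_snd.
  apply: measurable_funM; last exact: measurableT_comp mw measurable_fst.
  apply: measurable_funM; last exact: measurableT_comp mh measurable_fst.
  apply: measurableT_comp => //; apply: measurableT_comp => //.
  apply: measurable_funM => //; apply: measurable_funM => //.
  exact: measurableT_comp mT measurable_fst.
have f0 z : (0 <= f z)%E.
  rewrite lee_fin; apply: mulr_ge0; first exact: powR_ge0.
  apply: mulr_ge0 (hermite_weight_ge0 _ _).
  by apply: mulr_ge0 (h0 _); exact: expR_ge0.
have mhT : measurable_fun setT (fun x => h x * trace_sq x `^ (- (a + 1))).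
  by apply: measurable_funM => //; exact: measurableT_comp (measurable_powR _) mT.
transitivity (\int[@entries_lebesgue R N]_(x in @b_positive R N)
    \int[mu]_(l in `]0%R, +oo[) f (x, l))%E.
  rewrite /hermite_int -ge0_integralZr//; last 3 first.
  - exact: measurable_hermite_int.
  - move=> x _; rewrite lee_fin; apply: mulr_ge0 (hermite_weight_ge0 _ _).
    by apply: mulr_ge0 (h0 x) _; exact: powR_ge0.
  - by apply: integral_ge0 => l _; rewrite lee_fin mulr_ge0 ?powR_ge0 ?expR_ge0.
  apply: eq_integral => x /set_mem xpos; have T0 := trace_sq_gt0 N2 xpos.
  transitivity ((h x * hermite_weight beta x)%:E *
    \int[mu]_(l in `]0%R, +oo[) (l `^ a * expR (- (l * (trace_sq x / 2))))%:E)%E.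
    by rewrite gamma_int_scale// muleA -EFinM mulrAC.
  rewrite -ge0_integralZl//.
  - by apply: eq_integral => l _; rewrite -EFinM /f/=; congr EFin; ring.
  - apply: measurable_funTS; apply/measurable_EFinP; apply: measurable_funM; first exact: measurable_powR.
    apply: measurableT_comp => //; apply: measurableT_comp => //.
    exact: measurable_funM.
  - by move=> l _; rewrite lee_fin mulr_ge0 ?powR_ge0 ?expR_ge0.
  - by rewrite lee_fin mulr_ge0 ?hermite_weight_ge0.
transitivity (\int[mu]_(l in `]0%R, +oo[)
    \int[@entries_lebesgue R N]_(x in @b_positive R N) f (x, l))%E.
  exact: (fubini_tonelli_on (@entries_lebesgue R N) mu mB mJ mf f0).
rewrite /beta_int -ge0_integralZl//; last 3 first.
- apply: measurable_funTS; apply/measurable_EFinP; apply: measurable_funM; first exact: measurable_powR.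
  by apply: (measurableT_comp (measurable_powR _)); exact: measurable_funD.
- by move=> l _; rewrite lee_fin mulr_ge0 ?powR_ge0.
- exact: hermite_int_ge0.
apply: eq_integral => l /set_mem; rewrite /= in_itv/= andbT => l0.
rewrite EFinM [RHS]muleCA [X in (_ = _ * X)%E]muleC -hermite_int_expR ?ltW//.
rewrite /hermite_int -ge0_integralZl//.
- apply: measurable_hermite_int; apply: measurable_funM => //.
  apply: measurableT_comp => //; apply: measurableT_comp => //.
  by apply: measurable_funM => //; exact: measurable_funM.
- move=> x _; rewrite lee_fin; apply: mulr_ge0 (hermite_weight_ge0 _ _).
  by apply: mulr_ge0 (h0 x); exact: expR_ge0.
- by rewrite lee_fin powR_ge0.
Qed.

End mellin.

(** * Moments and factorization of homogeneous integrals *)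

Section moments.
Context {R : realType}.
Notation mu := (@lebesgue_measure R).
Notation RT := (measurableTypeR R).
Local Notation entries N := (N.-tuple RT * N.-1.-tuple RT)%type.

Lemma homogeneousM N (d1 d2 : R) (h1 h2 : entries N -> R) :
  homogeneous d1 h1 -> homogeneous d2 h2 ->
  homogeneous (d1 + d2) (fun x => h1 x * h2 x).
Proof.
move=> hh1 hh2 c x c0 xpos; rewrite hh1// hh2// powRD ?(gt_eqF c0) ?implybT//.
by rewrite mulrACA.
Qed.

Lemma homogeneous_trace_sq N : homogeneous 2 (@trace_sq R N).
Proof. by move=> c x c0 _; rewrite trace_sq_dilate -powR_mulrn// ltW. Qed.

Lemma homogeneous_trace_sq_powR N (p : R) :
  homogeneous (2 * p) (fun x : entries N => trace_sq x `^ p).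
Proof.
move=> c x c0 xpos; rewrite homogeneous_trace_sq// powRM ?powR_ge0 ?trace_sq_ge0//.
by rewrite -powRrM.
Qed.

Lemma measurable_trace_sq_powR N (p : R) :
  measurable_fun setT (fun x : entries N => trace_sq x `^ p).
Proof. exact: measurableT_comp (measurable_powR p) (@measurable_trace_sq R N). Qed.

(** The case a = 0 of [hermite_int_mellin], applied to h T rather than to h so
    that the power of T disappears from the left-hand side. *)
Lemma hermite_int_trace_sq N (beta d : R) (h : entries N -> R) :
  (2 <= N)%N -> 0 <= beta -> 0 <= d ->
  measurable_fun setT h -> (forall x, 0 <= h x) -> homogeneous d h ->
  (hermite_int beta (fun x => h x * trace_sq x)%R =
   hermite_int beta h * (hermite_dim N beta + d)%:E)%E.
Proof.
move=> N2 b0 d0 mh h0 hd.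
have Dd : 0 < hermite_dim N beta + d.
  by rewrite ltr_wpDr// hermite_dim_gt0// ltnW.
have mhT : measurable_fun setT (fun x => h x * trace_sq x).
  by apply: measurable_funM => //; exact: measurable_trace_sq.
have hT0 x : 0 <= h x * trace_sq x by apply: mulr_ge0 (h0 x) (trace_sq_ge0 x).
have := hermite_int_mellin beta 0 N2 mhT hT0 (homogeneousM hd (@homogeneous_trace_sq N)).
have -> : (hermite_dim N beta + (d + 2)) / 2 = 1 + (hermite_dim N beta + d) / 2 by field.
rewrite gamma_int0 beta_int0; last by rewrite ltrDl divr_gt0.
rewrite [X in (X - 1)^-1]addrC addrK invf_div.
rewrite (@eq_hermite_int _ _ _ _ h); last first.
  move=> x xpos; have T0 := trace_sq_gt0 N2 xpos.
  by rewrite add0r powR_inv1 ?trace_sq_ge0// mulfK// gt_eqF.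
move=> /(congr1 (fun u => u * ((hermite_dim N beta + d) / 2)%:E))%E.
rewrite -!muleA -!EFinM => E.
have e1 : 2 * ((hermite_dim N beta + d) / 2) = hermite_dim N beta + d by field.
have e2 : 2 / (hermite_dim N beta + d) * ((hermite_dim N beta + d) / 2) = 1.
  by field; rewrite gt_eqF.
by rewrite e1 e2 mule1 in E.
Qed.

Lemma hermite_int_trace_sqX N (beta : R) k :
  (2 <= N)%N -> 0 <= beta ->
  (hermite_int beta (fun x : entries N => trace_sq x ^+ k)%R =
   hermite_int beta (cst 1%R : entries N -> R) *
   (\prod_(i < k) (hermite_dim N beta + 2 * i%:R)%R)%:E)%E.
Proof.
move=> N2 b0; elim: k => [|k IH].
  by rewrite big_ord0 mule1; apply: eq_hermite_int => x _; rewrite expr0.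
rewrite big_ord_recr/= EFinM muleA -IH.
have hk : homogeneous (2 * k%:R) (fun x : entries N => trace_sq x ^+ k).
  move=> c x c0 xpos; rewrite trace_sq_dilate exprMn -exprM.
  by rewrite -[2 * k%:R]natrM powR_mulrn// ltW.
have k0 : 0 <= 2 * k%:R :> R by rewrite mulr_ge0.
rewrite -(hermite_int_trace_sq N2 b0 k0 _ _ hk).
- by apply: eq_hermite_int => x _; rewrite exprSr.
- by apply: measurable_funX; exact: measurable_trace_sq.
- by move=> x; rewrite exprn_ge0// trace_sq_ge0.
Qed.

(** On [1, 2] the integrand is at least exp (- 1). *)
Lemma gamma_int_gt0 (a : R) : 0 <= a -> (0 < gamma_int a)%E.
Proof.
move=> a0.
have f0 (l : R) : (0 <= (l `^ a * expR (- (l / 2)))%:E)%E.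
  by rewrite lee_fin; apply: mulr_ge0; [exact: powR_ge0|exact: expR_ge0].
have mf : measurable_fun setT (fun l : RT => (l `^ a * expR (- (l / 2)))%:E).
  apply/measurable_EFinP; apply: measurable_funM; first exact: measurable_powR.
  apply: measurableT_comp => //; apply: measurableT_comp => //.
  exact: measurable_funM.
apply: (@lt_le_trans _ _ (\int[mu]_(l in `[1%R, 2%R]) (expR (- 1))%:E)%E).
  rewrite integral_cst//= lebesgue_measure_itv/= lte_fin ltr1n -EFinB -EFinM lte_fin.
  by rewrite mulr_gt0 ?expR_gt0// subr_gt0 ltr1n.
apply: (@le_trans _ _ (\int[mu]_(l in `[1%R, 2%R]) (l `^ a * expR (- (l / 2)))%:E)%E).
  apply: ge0_le_integral => //.
  - exact: measurable_funTS.
  - move=> l; rewrite /= in_itv/= => /andP[l1 l2]; rewrite lee_fin.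
    rewrite -[leLHS]mul1r ler_pM ?expR_ge0//.
      by rewrite -(powRr0 l); exact: ler_powR.
    by rewrite ler_expR lerN2 ler_pdivrMr ?mul1r.
apply: ge0_subset_integral => //; first exact: measurable_funTS.
by move=> l; rewrite /= !in_itv/= andbT => /andP[l1 _]; rewrite (lt_le_trans _ l1).
Qed.

(** l^a <= (1 + l)^a compares the integrand with that of beta_int 0 q. *)
Lemma beta_int_lty (a q : R) : 0 <= a -> 1 < q -> (beta_int a (q + a) < +oo)%E.
Proof.
move=> a0 q1; apply: (@le_lt_trans _ _ (beta_int 0 q)); last by rewrite beta_int0// ltry.
have mf (u v : R) : measurable_fun (`]0%R, +oo[%classic : set RT)
    (fun l : RT => (l `^ u * (1 + l) `^ (- v))%:E).
  apply: measurable_funTS; apply/measurable_EFinP.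
  apply: measurable_funM; first exact: measurable_powR.
  by apply: (measurableT_comp (measurable_powR _)); exact: measurable_funD.
apply: ge0_le_integral => //.
- by move=> l _; rewrite lee_fin; apply: mulr_ge0; exact: powR_ge0.
- move=> l; rewrite /= in_itv/= andbT => l0; have l1 : 0 < 1 + l by rewrite ltr_wpDr// ltW.
  rewrite lee_fin powRr0 mul1r opprD powRD ?(gt_eqF l1) ?implybT//.
  rewrite mulrCA -[leRHS]mulr1 ler_wpM2l ?powR_ge0// powRN ler_pdivrMr ?powR_gt0// mul1r.
  by rewrite ge0_ler_powR ?nnegrE ?lerDr// ltW.
Qed.

(** [hermite_int_mellin] is applied to h T: the weight is then l^p with p >= 0,
    bounded near l = 0, and the extra factor T is removed by
    [hermite_int_trace_sq].  The second factor on the right depends on p and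
    on the ensemble, but not on h. *)
Lemma hermite_int_powR N (beta p : R) (h : entries N -> R) :
  (2 <= N)%N -> 0 <= beta -> 0 <= p ->
  measurable_fun setT h -> (forall x, 0 <= h x) -> homogeneous (2 * p) h ->
  (hermite_int beta (fun x => h x * trace_sq x `^ (- p))%R * gamma_int p =
   hermite_int beta h *
   ((hermite_dim N beta + 2 * p)%:E *
    beta_int p (hermite_dim N beta / 2 + 1 + p)))%E.
Proof.
move=> N2 b0 p0 mh h0 hp.
have mhT : measurable_fun setT (fun x => h x * trace_sq x).
  by apply: measurable_funM => //; exact: measurable_trace_sq.
have hT0 x : 0 <= h x * trace_sq x by apply: mulr_ge0 (h0 x) (trace_sq_ge0 x).
have := hermite_int_mellin beta p N2 mhT hT0 (homogeneousM hp (@homogeneous_trace_sq N)).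
rewrite (hermite_int_trace_sq N2 b0 (mulr_ge0 (ler0n _ 2) p0) mh h0 hp) -muleA.
have -> : (hermite_dim N beta + (2 * p + 2)) / 2 = hermite_dim N beta / 2 + 1 + p by field.
move=> <-; congr (_ * _)%E; apply: eq_hermite_int => x xpos.
have T0 := trace_sq_gt0 N2 xpos.
rewrite -mulrA; congr (_ * _); rewrite opprD powRD ?(gt_eqF T0) ?implybT//.
by rewrite powR_inv1 ?ltW// mulrCA divff ?mulr1// gt_eqF.
Qed.

Section finite_mass.
Variables (N : nat) (beta : R).
Hypotheses (N2 : (2 <= N)%N) (beta_ge0 : 0 <= beta).
Let Z : \bar R := hermite_int beta (cst 1 : entries N -> R).
Hypotheses (Z_gt0 : (0 < Z)%E) (Z_lty : (Z < +oo)%E).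

(** T^p <= 1 + T^k for an integer k >= p, and the integer moments are finite
    multiples of the total mass. *)
Lemma hermite_int_trace_sq_powR_lty (p : R) : 0 <= p ->
  (hermite_int beta (fun x : entries N => trace_sq x `^ p)%R < +oo)%E.
Proof.
move=> p0; set k := (Num.truncn p).+1.
have pk : p <= k%:R by rewrite ltW// truncnS_gt.
have mT := @measurable_trace_sq R N.
apply: (@le_lt_trans _ _ (Z + hermite_int beta (fun x : entries N => trace_sq x ^+ k)%R)%E).
  rewrite /Z /hermite_int -ge0_integralD//=; last 5 first.
  - exact: measurable_b_positive.
  - by move=> x _; rewrite lee_fin mul1r; exact: hermite_weight_ge0.
  - exact: (@measurable_hermite_int _ _ beta _ (cst 1)).
  - move=> x _; rewrite lee_fin; apply: mulr_ge0 (hermite_weight_ge0 _ _).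
    by apply: exprn_ge0; exact: trace_sq_ge0.
  - by apply: measurable_hermite_int; exact: measurable_funX.
  apply: ge0_le_integral.
  - exact: measurable_b_positive.
  - move=> x _; rewrite lee_fin; apply: mulr_ge0 (hermite_weight_ge0 _ _); exact: powR_ge0.
  - by apply: measurable_hermite_int; exact: measurable_trace_sq_powR.
  - apply: emeasurable_funD.
      exact: (@measurable_hermite_int _ _ beta _ (cst 1)).
    by apply: measurable_hermite_int; exact: measurable_funX.
  - move=> x _; rewrite -EFinD lee_fin -mulrDl.
    apply: ler_wpM2r; first exact: hermite_weight_ge0.
    have T0 := trace_sq_ge0 x.
    have [T1|T1] := leP (trace_sq x) 1.
      apply: (@le_trans _ _ 1); last by rewrite lerDl exprn_ge0.
      have <- : 1 `^ p = 1 :> R by rewrite powR1.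
      by rewrite ge0_ler_powR ?nnegrE.
    apply: (@le_trans _ _ (trace_sq x ^+ k)); last by rewrite lerDr.
    by rewrite -powR_mulrn//; apply: ler_powR => //; exact: ltW.
rewrite hermite_int_trace_sqX// lte_add_pinfty//.
rewrite -/Z -(fineK (_ : Z \is a fin_num)) -?EFinM ?ltry//.
by rewrite ge0_fin_numE// ltW.
Qed.

Lemma hermite_int_trace_sq_powR_gt0 (p : R) : 0 <= p ->
  (0 < hermite_int beta (fun x : entries N => trace_sq x `^ p)%R)%E.
Proof.
move=> p0; rewrite lt_neqAle hermite_int_ge0 ?andbT; last by move=> x; exact: powR_ge0.
apply/eqP => T0; have := hermite_int_powR N2 beta_ge0 p0 (@measurable_trace_sq_powR N p)
  (fun x => powR_ge0 _ _) (@homogeneous_trace_sq_powR N p).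
rewrite -T0 mul0e (@eq_hermite_int _ _ _ _ (cst 1)); last first.
  move=> x xpos; rewrite -powRD ?(gt_eqF (trace_sq_gt0 N2 xpos)) ?implybT//.
  by rewrite subrr powRr0.
by move=> /eqP; rewrite gt_eqF// mule_gt0// gamma_int_gt0.
Qed.

(** [hermite_int_powR] for h and for T^p involves the same two constants K
    and B: I(h T^(-p)) K = I(h) B and I(1) K = I(T^p) B.  Eliminating B gives
    the claim multiplied by K.  To cancel K one needs K finite, which is read
    off from I(1) K = I(T^p) B with I(1) > 0 and the right-hand side finite. *)
Lemma hermite_int_factor (p : R) (h : entries N -> R) : 0 <= p ->
  measurable_fun setT h -> (forall x, 0 <= h x) -> homogeneous (2 * p) h ->
  (hermite_int beta (fun x => h x * trace_sq x `^ (- p))%R *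
   hermite_int beta (fun x : entries N => trace_sq x `^ p)%R =
   hermite_int beta h * Z)%E.
Proof.
move=> p0 mh h0 hp; set X := hermite_int _ _; set Y := hermite_int _ _.
set H := hermite_int _ h.
have EX := hermite_int_powR N2 beta_ge0 p0 mh h0 hp.
have EY := hermite_int_powR N2 beta_ge0 p0 (@measurable_trace_sq_powR N p)
  (fun x => powR_ge0 _ _) (@homogeneous_trace_sq_powR N p).
rewrite (@eq_hermite_int _ _ _ _ (cst 1)) -/Z -/Y in EY; last first.
  move=> x xpos; rewrite -powRD ?(gt_eqF (trace_sq_gt0 N2 xpos)) ?implybT//.
  by rewrite subrr powRr0.
rewrite -/X -/H in EX; set B := (_ * beta_int _ _)%E in EX EY.
have K0 := gamma_int_gt0 p0.
have D0 : 0 < hermite_dim N beta by rewrite hermite_dim_gt0// ltnW.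
have B0 : (0 <= B)%E.
  apply: mule_ge0; first by rewrite lee_fin addr_ge0// ?mulr_ge0// ltW.
  by apply: integral_ge0 => l _; rewrite lee_fin; apply: mulr_ge0; exact: powR_ge0.
have Blty : (B < +oo)%E.
  apply: lte_mul_pinfty => //; first by rewrite lee_fin addr_ge0 ?mulr_ge0 ?(ltW D0).
  by apply: beta_int_lty => //; rewrite ltrDr divr_gt0.
have Y0 : (0 <= Y)%E by apply: hermite_int_ge0 => x; exact: powR_ge0.
have YB : (Y * B < +oo)%E.
  apply: lte_mul_pinfty => //.
  by rewrite ge0_fin_numE//; exact: hermite_int_trace_sq_powR_lty.
have Kfin : gamma_int p \is a fin_num.
  rewrite ge0_fin_numE; last exact: ltW.
  rewrite ltNge leye_eq; apply/negP => /eqP K; move: YB.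
  by rewrite -EY K gt0_muley.
have E : (X * Y * gamma_int p = H * Z * gamma_int p)%E.
  by rewrite muleAC EX -muleA [(B * Y)%E]muleC -EY muleA.
have K1 : (gamma_int p * (fine (gamma_int p))^-1%:E = 1)%E.
  rewrite -{1}(fineK Kfin) -EFinM divff// gt_eqF// fine_gt0// K0/=.
  by rewrite -ge0_fin_numE// ltW.
by have := congr1 (fun u => u * (fine (gamma_int p))^-1%:E)%E E; rewrite -!muleA K1 !mule1.
Qed.

End finite_mass.
End moments.

(** * Expectations in the two ensembles *)

Section expectation.
Context {R : realType}.
Notation RT := (measurableTypeR R).
Local Notation entries N := (N.-tuple RT * N.-1.-tuple RT)%type.

Lemma hermite_mass_setT N (beta : R) :
  @hermite_mass R N beta setT = hermite_int beta (cst 1 : entries N -> R).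
Proof. by rewrite /hermite_mass setTI; apply: eq_integral => x _; rewrite mul1r. Qed.

(** From here on the mass of the weight is positive and finite, so that the
    ensemble is the normalized weight. *)
Section regular.
Variables (N : nat) (beta : R).
Hypotheses (N2 : (2 <= N)%N) (beta_ge0 : 0 <= beta).
Let Z : \bar R := hermite_int beta (cst 1 : entries N -> R).
Hypotheses (Z_gt0 : (0 < Z)%E) (Z_lty : (Z < +oo)%E).
Let P := hermite_ensemble N beta.
Let D := hermite_dim N beta.

Let Z_fin : Z \is a fin_num.
Proof. by rewrite ge0_fin_numE// ltW. Qed.

Let fineZ_gt0 : 0 < fine Z.
Proof. by rewrite fine_gt0// Z_gt0. Qed.

Let ZV : ((fine Z)^-1%:E * Z = 1)%E.
Proof. by rewrite -[X in (_ * X)%E](fineK Z_fin) -EFinM mulVf ?gt_eqF. Qed.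

Let D_gt0 : 0 < D.
Proof. by rewrite hermite_dim_gt0// ltnW. Qed.

Lemma ge0_integral_hermite (h : entries N -> R) :
  measurable_fun setT h -> (forall x, 0 <= h x) ->
  (\int[P]_x (h x)%:E = (fine Z)^-1%:E * hermite_int beta h)%E.
Proof.
move=> mh h0; have mw := @measurable_hermite_weight R N beta.
have mB := @measurable_b_positive R N.
have z0 : 0 <= (fine Z)^-1 by rewrite invr_ge0 ltW.
rewrite (@ge0_integral_density _ _ _ (@entries_lebesgue R N) P (@b_positive R N)
  (fun x => (fine Z)^-1 * hermite_weight beta x) (EFin \o h)) //.
- rewrite /hermite_int -ge0_integralZl//.
  + by apply: eq_integral => x _; rewrite -!EFinM; congr EFin; ring.
  + exact: measurable_hermite_int.
  + by move=> x _; rewrite lee_fin; apply: mulr_ge0 (h0 x) (hermite_weight_ge0 _ _).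
- by apply: measurable_funM.
- by move=> x; apply: mulr_ge0 z0 (hermite_weight_ge0 _ _).
- move=> A mA; rewrite /P/= /mnormalize/= hermite_mass_setT -/Z.
  rewrite gt_eqF//= lt_eqF//= muleC /hermite_mass.
  rewrite -ge0_integralZl//.
  + exact: measurableI.
  + by apply/measurable_EFinP; exact: measurable_funTS.
  + by move=> x _; rewrite lee_fin; exact: hermite_weight_ge0.
- exact/measurable_EFinP.
Qed.

Let Tp (p : R) : \bar R := (\int[P]_x (trace_sq x `^ p)%:E)%E.

Lemma integral_trace_sq_powR_fin_num p : 0 <= p -> Tp p \is a fin_num.
Proof.
move=> p0; rewrite ge0_fin_numE; last first.
  by apply: integral_ge0 => x _; rewrite lee_fin; exact: powR_ge0.
rewrite /Tp ge0_integral_hermite; last 2 first.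
- exact: measurable_trace_sq_powR.
- by move=> x; exact: powR_ge0.
by apply: lte_mul_pinfty => //; [rewrite lee_fin invr_ge0 ltW|exact: hermite_int_trace_sq_powR_lty].
Qed.

Lemma integral_trace_sq_powR_gt0 p : 0 <= p -> 0 < fine (Tp p).
Proof.
move=> p0; rewrite -lte_fin fineK; last exact: integral_trace_sq_powR_fin_num.
rewrite /Tp ge0_integral_hermite; last 2 first.
- exact: measurable_trace_sq_powR.
- by move=> x; exact: powR_ge0.
by rewrite mule_gt0 ?lte_fin ?invr_gt0// hermite_int_trace_sq_powR_gt0.
Qed.

Lemma integral_trace_sqX k :
  (\int[P]_x (trace_sq x ^+ k)%:E = (\prod_(i < k) (D + 2 * i%:R)%R)%:E)%E.
Proof.
rewrite ge0_integral_hermite; last 2 first.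
- by apply: measurable_funX; exact: measurable_trace_sq.
- by move=> x; apply: exprn_ge0; exact: trace_sq_ge0.
by rewrite hermite_int_trace_sqX// -/Z muleA ZV mul1e.
Qed.

Lemma strengthE : strength N beta = Num.sqrt D.
Proof.
rewrite /strength unlock; congr Num.sqrt.
rewrite -[RHS]/(fine D%:E); congr fine.
have := integral_trace_sqX 1; rewrite big_ord1 mulr0 addr0 => <-.
by apply: eq_integral => x _; rewrite expr1.
Qed.

(** The independence of T and x / sqrt T: the expectation of h at the rescaled
    point is r^(2 p) times that of h T^(- p), and [hermite_int_factor] divides
    the expectation of h by that of T^p. *)
Lemma ge0_integral_rescale (p r : R) (h : entries N -> R) : 0 <= p -> 0 < r ->
  measurable_fun setT h -> (forall x, 0 <= h x) -> homogeneous (2 * p) h ->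
  (\int[P]_x (h (rescale r x))%:E =
   (r `^ (2 * p) / fine (Tp p))%:E * \int[P]_x (h x)%:E)%E.
Proof.
move=> p0 r0 mh h0 hp.
have mhT : measurable_fun setT (fun x => h x * trace_sq x `^ (- p)).
  by apply: measurable_funM => //; exact: measurable_trace_sq_powR.
have hT0 x : 0 <= h x * trace_sq x `^ (- p) by apply: mulr_ge0 (h0 x) _; exact: powR_ge0.
have -> : (\int[P]_x (h (rescale r x))%:E =
    (r `^ (2 * p))%:E * \int[P]_x (h x * trace_sq x `^ (- p))%:E)%E.
  rewrite !ge0_integral_hermite//; last first.
    exact: measurableT_comp mh (@measurable_rescale R N r).
  rewrite muleCA; congr (_ * _)%E.
  rewrite /hermite_int -ge0_integralZl//; last 4 first.
  - exact: measurable_b_positive.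
  - exact: measurable_hermite_int.
  - by move=> x _; rewrite lee_fin; apply: mulr_ge0 (hT0 x) (hermite_weight_ge0 _ _).
  - by rewrite lee_fin powR_ge0.
  apply: eq_integral => x /set_mem xpos; have T0 := trace_sq_gt0 N2 xpos.
  have -> : h (rescale r x) = r `^ (2 * p) * (h x * trace_sq x `^ (- p)).
    rewrite -[rescale r x]/(dilate (r / Num.sqrt (trace_sq x)) x).
    rewrite hp// ?divr_gt0 ?sqrtr_gt0// [RHS]mulrCA mulrC; congr (_ * _).
    rewrite powRM ?invr_ge0 ?sqrtr_ge0 ?(ltW r0)//; congr (_ * _).
    rewrite -powR12_sqrt ?(ltW T0)// -powRN -powRrM; congr (_ `^ _).
    by rewrite mulNr mulrA mulVf ?mul1r ?pnatr_eq0.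
  by rewrite -mulrA EFinM.
rewrite EFinM -muleA; congr (_ * _)%E.
have F := hermite_int_factor N2 beta_ge0 Z_gt0 Z_lty p0 mh h0 hp.
have Tp0 := integral_trace_sq_powR_gt0 p0.
have E : (\int[P]_x (h x * trace_sq x `^ (- p))%:E * (fine (Tp p))%:E = \int[P]_x (h x)%:E)%E.
  rewrite (fineK (integral_trace_sq_powR_fin_num p0)) /Tp !ge0_integral_hermite//; last 2 first.
  - exact: measurable_trace_sq_powR.
  - by move=> x; exact: powR_ge0.
  rewrite muleACA F -/Z [X in (_ * X)%E]muleC muleACA.
  by rewrite ZV mul1e.
by rewrite -E [RHS]muleC -muleA -EFinM divff ?mule1// gt_eqF.
Qed.

(** The factor is the same for the positive and the negative part of f, both
    of which are homogeneous. *)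
Lemma integral_fixed_trace (p r : R) (f : entries N -> R) : 0 <= p -> 0 < r ->
  measurable_fun setT f -> homogeneous (2 * p) f ->
  P.-integrable setT (EFin \o f) ->
  (\int[fixed_trace_ensemble N beta r]_x (f x)%:E =
   (r `^ (2 * p) / fine (Tp p))%:E * \int[P]_x (f x)%:E)%E.
Proof.
move=> p0 r0 mf hp fint.
have mEf : measurable_fun setT (EFin \o f) by exact/measurable_EFinP.
have part (g : entries N -> R) : measurable_fun setT g -> (forall x, 0 <= g x) ->
    homogeneous (2 * p) g ->
    (\int[fixed_trace_ensemble N beta r]_x (g x)%:E =
      (r `^ (2 * p) / fine (Tp p))%:E * \int[P]_x (g x)%:E)%E.
  move=> mg g0 hg; rewrite -ge0_integral_rescale// ge0_integral_distribution//.
  exact/measurable_EFinP.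
have posE : ((EFin \o f)^\+)%E = EFin \o (fun x => Num.max (f x) 0).
  by apply/funext => x; rewrite unlock /= -EFin_max.
have negE : ((EFin \o f)^\-)%E = EFin \o (fun x => Num.max (- f x) 0).
  by apply/funext => x; rewrite unlock /= EFin_max EFinN.
have a_fin := integrable_pos_fin_num measurableT fint.
have b_fin := integrable_neg_fin_num measurableT fint.
rewrite integralE [in RHS]integralE posE negE.
rewrite posE in a_fin; rewrite negE in b_fin.
rewrite part; last 3 first.
- exact: measurable_maxr.
- by move=> x; rewrite le_max lexx orbT.
- by move=> c x c0 xpos; rewrite hp// maxr_pMr ?powR_ge0// mulr0.
rewrite part; last 3 first.
- by apply: measurable_maxr => //; exact: measurableT_comp.
- by move=> x; rewrite le_max lexx orbT.
- by move=> c x c0 xpos; rewrite hp// maxr_pMr ?powR_ge0// mulr0 mulrN.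
rewrite -(fineK a_fin) -(fineK b_fin) -!EFinM -!EFinB.
by rewrite mulrBr.
Qed.
End regular.
End expectation.

(** * The ratio of moments and its limit *)

Section ratio.
Context {R : realType}.
Notation RT := (measurableTypeR R).
Local Notation entries N := (N.-tuple RT * N.-1.-tuple RT)%type.

(** The k-th moment of [trace_sq] / D, see [integral_trace_sqX]. *)
Definition trace_moment (D : R) k : R := \prod_(i < k) (1 + 2 * i%:R / D).

Lemma measurable_rpow (e : R) : measurable_fun setT (fun x : RT => rpow x e).
Proof.
rewrite /rpow; case: (e \is a Num.nat); last exact: measurable_powR.
exact: exprn_measurable.
Qed.

Lemma measurable_monomial N (ea : 'I_N -> R) (eb : 'I_N.-1 -> R) :
  measurable_fun setT (monomial ea eb).
Proof.
apply: measurable_funM; apply: measurable_prod => j _.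
- exact: measurableT_comp (measurable_rpow _) (measurable_a j).
- exact: measurableT_comp (measurable_rpow _) (measurable_b j).
Qed.

(** For negative x only natural exponents are admissible, and there [rpow] is
    the algebraic power. *)
Lemma rpowM (c x e : R) : 0 < c -> rpow_defined x e ->
  rpow (c * x) e = c `^ e * rpow x e.
Proof.
rewrite /rpow => c0 def; case: ifPn => en.
  have eE : (Num.truncn e)%:R = e by apply/eqP; rewrite -natrEtruncn.
  by rewrite exprMn -[in RHS]eE powR_mulrn ?eE// ltW.
case: def => [x0|]; last by rewrite (negbTE en).
by rewrite powRM// ltW.
Qed.

Lemma homogeneous_monomial N (ea : 'I_N -> R) (eb : 'I_N.-1 -> R) :
  (forall x : entries N, b_positive x ->
     (forall j, rpow_defined (tnth x.1 j) (ea j)) /\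
     (forall j, rpow_defined (tnth x.2 j) (eb j))) ->
  homogeneous (\sum_j ea j + \sum_j eb j) (monomial ea eb).
Proof.
move=> def c x c0 /def[defa defb]; rewrite /monomial.
under eq_bigr do rewrite tnth_mktuple rpowM//.
under [X in _ * X = _]eq_bigr do rewrite tnth_mktuple rpowM//.
rewrite !big_split/= !prod_powR// powRD ?(gt_eqF c0) ?implybT//.
by rewrite mulrACA.
Qed.

(** y^p lies between 1 = y^0 and y^k, on either side of y = 1. *)
Lemma dist_powR_le (y p : R) k : 0 <= y -> 0 <= p <= k%:R ->
  `|y `^ p - 1| <= `|y ^+ k - 1|.
Proof.
move=> y0 /andP[p0 pk]; rewrite -powR_mulrn//.
have p1 q : 1 `^ q = 1 :> R by rewrite powR1.
have [y1|y1] := leP 1 y.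
  rewrite !ger0_norm ?subr_ge0 ?lerB ?ler_powR//.
  - by rewrite -[leLHS](powRr0 y) ler_powR.
  - by rewrite -[leLHS](powRr0 y) ler_powR.
have yq q : 0 <= q -> y `^ q <= 1.
  by move=> q0; rewrite -[leRHS](p1 q) ge0_ler_powR ?nnegrE// ltW.
rewrite !ler0_norm ?subr_le0 ?yq// ?lerN2 ?lerB//.
have [->|yn0] := eqVneq y 0.
  have [->|pn0] := eqVneq p 0; last first.
    have p_gt0 : 0 < p by rewrite lt_neqAle eq_sym pn0.
    by rewrite (powR0 pn0) powR0// gt_eqF// (lt_le_trans p_gt0).
  by rewrite powRr0 -[leRHS](p1 k%:R) ge0_ler_powR ?nnegrE.
by rewrite ger_powR// lt_neqAle eq_sym yn0 y0 ltW.
Qed.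

(** The difference of the two sides is (|x| - e)^2 / (2 e). *)
Lemma ler_sqrM_eps (x e : R) : 0 < e -> `|x| <= (e + x ^+ 2 / e) / 2.
Proof.
move=> e0; rewrite -real_normK ?num_real//; set u := `|x|.
have -> : (e + u ^+ 2 / e) / 2 = u + (u - e) ^+ 2 / (2 * e).
  by field; rewrite gt_eqF.
by rewrite lerDl divr_ge0 ?sqr_ge0// mulr_ge0// ltW.
Qed.

Section one_size.
Variables (N : nat) (beta s : R) (ea : 'I_N -> R) (eb : 'I_N.-1 -> R).
Hypotheses (N2 : (2 <= N)%N) (beta_ge0 : 0 <= beta).
Hypotheses (ea_ge0 : forall j, 0 <= ea j) (eb_ge0 : forall j, 0 <= eb j).
Hypothesis e_sum : \sum_j ea j + \sum_j eb j = s.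
Let P := hermite_ensemble N beta.
Let D := hermite_dim N beta.
Hypothesis M_defined : moment_defined P ea eb.
Hypothesis M_neq0 : moment P ea eb <> 0.
Let Z : \bar R := hermite_int beta (cst 1 : entries N -> R).

Let s_ge0 : 0 <= s.
Proof. by rewrite -e_sum addr_ge0// sumr_ge0. Qed.

Let D_gt0 : 0 < D.
Proof. by rewrite hermite_dim_gt0// ltnW. Qed.

(** At the zero matrix every factor with a nonzero exponent vanishes, so a
    nonzero moment leaves only the constant monomial, whose moment is 1 for
    any probability. *)
Lemma moment_ratio_degenerate : ~~ ((0 < Z)%E && (Z < +oo)%E) ->
  moment (fixed_trace_ensemble N beta (strength N beta)) ea eb = moment P ea eb.
Proof.
move=> Zdeg; pose x0 : entries N := ([tuple 0 | _ < N], [tuple 0 | _ < N.-1]).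
have Pdirac : forall A, P A = dirac x0 A.
  move=> A; rewrite /P/= /mnormalize/= hermite_mass_setT -/Z ifT//.
  have : (0 <= Z)%E by exact: hermite_int_ge0.
  rewrite le_eqVlt => /predU1P[<-|Z0]; first by rewrite eqxx.
  by move: Zdeg; rewrite Z0/= ltey negbK => ->; rewrite orbT.
have M0 : moment P ea eb = monomial ea eb x0.
  rewrite /moment unlock.
  transitivity (fine (\int[dirac x0]_x (monomial ea eb x)%:E)).
    by congr fine; apply: eq_measure_integral => A _ _; exact: Pdirac.
  rewrite integral_dirac//; last by apply/measurable_EFinP; exact: measurable_monomial.
  by rewrite diracT mul1e.
have rpow0 (e : R) : rpow 0 e <> 0 -> e = 0.
  rewrite /rpow; case: ifPn => [en|_].
    rewrite expr0n; case: eqP => // tr0 _.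
    by have := en; rewrite natrEtruncn tr0 => /eqP.
  by move=> H; apply/eqP; apply: contra_notT H => e0; rewrite powR0.
have /andP[/prodf_neq0 Ha /prodf_neq0 Hb] :
    (\prod_j rpow (tnth x0.1 j) (ea j) != 0) && (\prod_j rpow (tnth x0.2 j) (eb j) != 0).
  by rewrite -negb_or -mulf_eq0; apply/eqP => Mx0; apply: M_neq0; rewrite M0.
have ea0 j : ea j = 0.
  by apply: rpow0; have := Ha j isT; rewrite tnth_mktuple => /eqP.
have eb0 j : eb j = 0.
  by apply: rpow0; have := Hb j isT; rewrite tnth_mktuple => /eqP.
have one : monomial ea eb = cst 1.
  apply/funext => x; rewrite /monomial !big1 ?mulr1// => j _.
    by rewrite eb0 /rpow rpred0 truncn0 expr0.
  by rewrite ea0 /rpow rpred0 truncn0 expr0.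
have oneE (Q : probability (entries N) R) : moment Q ea eb = 1.
  by rewrite /moment one expectation_cst.
by rewrite !oneE.
Qed.

Let Tp : R := fine (\int[P]_x (trace_sq x `^ (s / 2))%:E)%E.

Lemma moment_ratio_regular : (0 < Z)%E -> (Z < +oo)%E ->
  moment (fixed_trace_ensemble N beta (strength N beta)) ea eb =
  D `^ (s / 2) / Tp * moment P ea eb.
Proof.
move=> Z0 Zoo; have [def int] := M_defined.
have hp := homogeneous_monomial def; rewrite e_sum in hp.
have s2 : 0 <= s / 2 by rewrite divr_ge0.
have ss : s = 2 * (s / 2) by rewrite mulrCA divff ?mulr1.
rewrite ss in hp.
have r0 : 0 < strength N beta by rewrite strengthE// sqrtr_gt0.
have mM := measurable_monomial ea eb.
rewrite /moment unlock /=.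
rewrite (integral_fixed_trace N2 beta_ge0 Z0 Zoo s2 r0 mM hp int) fineM//; last first.
  exact: integrable_fin_num int.
congr (_ / _ * _).
rewrite strengthE// -powR12_sqrt ?ltW// -powRrM; congr (_ `^ _).
by rewrite mulrA mulVf ?mul1r.
Qed.

(** With y = T / D, integrate the pointwise bound
    |y^p - 1| <= |y^k - 1| <= (e + (y^k - 1)^2 / e) / 2. *)
Lemma trace_powR_bound (e : R) k : 0 < e -> s / 2 <= k%:R ->
  (0 < Z)%E -> (Z < +oo)%E ->
  `|Tp / D `^ (s / 2) - 1| <=
  (e + (trace_moment D (k + k) - 2 * trace_moment D k + 1) / e) / 2.
Proof.
move=> e0 sk Z0 Zoo.
have s2 : 0 <= s / 2 by rewrite divr_ge0.
have mT := @measurable_trace_sq R N.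
have powE (x : entries N) :
    ((trace_sq x / D) `^ (s / 2))%:E = ((D `^ (s / 2))^-1%:E * (trace_sq x `^ (s / 2))%:E)%E.
  rewrite powRM ?invr_ge0 ?(ltW D_gt0) ?trace_sq_ge0// mulrC EFinM.
  by rewrite -[D^-1]powR_inv1 ?(ltW D_gt0)// -powRrM mulN1r powRN.
have intX m : P.-integrable setT (EFin \o (fun x : entries N => (trace_sq x / D) ^+ m)).
  apply/integrableP; split.
    by apply/measurable_EFinP; apply: measurable_funX; exact: measurable_funM.
  under eq_integral => x _.
    rewrite /= ger0_norm; last by apply: exprn_ge0; apply: divr_ge0 (ltW D_gt0); exact: trace_sq_ge0.
    rewrite expr_div_n mulrC EFinM.
    over.
  rewrite ge0_integralZl//.
  - by rewrite integral_trace_sqX// -EFinM ltry.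
  - by apply/measurable_EFinP; exact: measurable_funX.
  - by move=> x _; rewrite lee_fin; apply: exprn_ge0; exact: trace_sq_ge0.
  - by rewrite lee_fin invr_ge0 exprn_ge0// ltW.
have EX m : (\int[P]_x ((trace_sq x / D) ^+ m) = trace_moment D m)%R.
  transitivity (fine (\int[P]_x ((D ^+ m)^-1%:E * (trace_sq x ^+ m)%:E))%E).
    by congr fine; apply: eq_integral => x _; rewrite expr_div_n mulrC EFinM.
  rewrite ge0_integralZl//; last 3 first.
  - by apply/measurable_EFinP; exact: measurable_funX.
  - by move=> x _; rewrite lee_fin; apply: exprn_ge0; exact: trace_sq_ge0.
  - by rewrite lee_fin invr_ge0 exprn_ge0// ltW.
  rewrite integral_trace_sqX// -EFinM /= /trace_moment.
  have <- : \prod_(i < m) D = D ^+ m by rewrite prodr_const card_ord.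
  rewrite -prodfV -big_split/=.
  by apply: eq_bigr => i _; rewrite -/D mulrDr mulVf ?gt_eqF// [D^-1 * _]mulrC.
have intp : P.-integrable setT (EFin \o (fun x : entries N => (trace_sq x / D) `^ (s / 2))).
  apply/integrableP; split.
    apply/measurable_EFinP; apply: (measurableT_comp (measurable_powR _)).
    exact: measurable_funM.
  under eq_integral do rewrite /= ger0_norm ?powR_ge0// powE.
  rewrite ge0_integralZl//.
  - rewrite -(fineK (integral_trace_sq_powR_fin_num N2 beta_ge0 Z0 Zoo s2)).
    by rewrite -EFinM ltry.
  - by apply/measurable_EFinP; exact: measurable_trace_sq_powR.
  - by move=> x _; rewrite lee_fin; exact: powR_ge0.
  - by rewrite lee_fin invr_ge0 powR_ge0.
have Ep : (\int[P]_x ((trace_sq x / D) `^ (s / 2)) = Tp / D `^ (s / 2))%R.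
  transitivity (fine (\int[P]_x ((D `^ (s / 2))^-1%:E * (trace_sq x `^ (s / 2))%:E))%E).
    by congr fine; apply: eq_integral => x _; rewrite -powE.
  rewrite ge0_integralZl//; last 3 first.
  - by apply/measurable_EFinP; exact: measurable_trace_sq_powR.
  - by move=> x _; rewrite lee_fin; exact: powR_ge0.
  - by rewrite lee_fin invr_ge0 powR_ge0.
  rewrite fineM//; last exact: integral_trace_sq_powR_fin_num.
  by rewrite mulrC.
(* All functions below are combinations of y^p, y^(2k), y^k and y^0. *)
have lin (a b : R) (f g : entries N -> R) :
    P.-integrable setT (EFin \o f) -> P.-integrable setT (EFin \o g) ->
    P.-integrable setT (EFin \o (fun x => a * f x + b * g x)) /\
    (\int[P]_x (a * f x + b * g x) = a * \int[P]_x f x + b * \int[P]_x g x)%R.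
  move=> fi gi.
  have afi : P.-integrable setT (EFin \o (fun x => a * f x)).
    exact: (integrableZl measurableT a fi).
  have bgi : P.-integrable setT (EFin \o (fun x => b * g x)).
    exact: (integrableZl measurableT b gi).
  split; first exact: (integrableD measurableT afi bgi).
  by rewrite RintegralD// !RintegralZl.
have E0 : trace_moment D 0 = 1 by rewrite /trace_moment big_ord0.
have [dint dE] := lin 1 (-1) _ _ intp (intX 0%N).
rewrite Ep EX E0 [X in _ = X + _]mul1r [X in _ = _ + X]mulN1r in dE.
have [q1int q1E] := lin (- e^-1) (e / 2 + (2 * e)^-1) _ _ (intX k) (intX 0%N).
have [qint qE] := lin (2 * e)^-1 1 _ _ (intX (k + k)%N) q1int.
rewrite q1E !EX E0 in qE.
have [nint nE] := lin (-1) 0 _ _ qint (intX 0%N).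
rewrite qE EX mul0r addr0 in nE.
have -> : (e + (trace_moment D (k + k) - 2 * trace_moment D k + 1) / e) / 2 =
    (2 * e)^-1 * trace_moment D (k + k) +
    1 * (- e^-1 * trace_moment D k + (e / 2 + (2 * e)^-1) * 1).
  by field; rewrite gt_eqF.
have bound (x : entries N) :
    `|1 * (trace_sq x / D) `^ (s / 2) + -1 * (trace_sq x / D) ^+ 0| <=
    (2 * e)^-1 * (trace_sq x / D) ^+ (k + k) +
    1 * (- e^-1 * (trace_sq x / D) ^+ k + (e / 2 + (2 * e)^-1) * (trace_sq x / D) ^+ 0).
  have y0 : 0 <= trace_sq x / D by apply: divr_ge0 (ltW D_gt0); exact: trace_sq_ge0.
  rewrite expr0 mul1r !mulr1; apply: le_trans (dist_powR_le y0 (k := k) _) _; first by rewrite s2.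
  apply: le_trans (ler_sqrM_eps _ e0) _; rewrite le_eqVlt; apply/orP; left; apply/eqP.
  by rewrite exprD; field; rewrite gt_eqF.
rewrite ler_norml; apply/andP; split.
- rewrite -[- (_ + _)]mulN1r -nE -dE; apply: le_Rintegral => // x _.
  rewrite mul0r addr0 [leLHS]mulN1r.
  by have := bound x; rewrite ler_norml => /andP[].
- rewrite -dE -qE; apply: le_Rintegral => // x _.
  by have := bound x; rewrite ler_norml => /andP[].
Qed.

(** The absolute value on the right keeps the bound nonnegative in the
    degenerate case, where the left-hand side is 0. *)
Lemma moment_ratio_bound (e : R) k : 0 < e -> s / 2 <= k%:R ->
  `|1 - (moment (fixed_trace_ensemble N beta (strength N beta)) ea eb /
         moment P ea eb)^-1| <=
  (e + `|trace_moment D (k + k) - 2 * trace_moment D k + 1| / e) / 2.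
Proof.
move=> e0 sk; have M0 : moment P ea eb != 0 by apply/eqP.
have [/andP[Z0 Zoo]|Zdeg] := boolP ((0 < Z)%E && (Z < +oo)%E); last first.
  rewrite moment_ratio_degenerate// divff// invr1 subrr normr0.
  by rewrite divr_ge0// addr_ge0 ?divr_ge0// ltW.
rewrite moment_ratio_regular// mulfK// invf_div distrC.
apply: le_trans (trace_powR_bound e0 sk Z0 Zoo) _.
by rewrite ler_pM2r ?invr_gt0// lerD2l ler_pM2r ?invr_gt0// ler_norm.
Qed.

End one_size.

Lemma cvg_trace_moment (beta : R) k : 0 <= beta ->
  trace_moment (hermite_dim N beta) k @[N --> \oo] --> (1 : R).
Proof.
move=> b0; have Doo : hermite_dim N beta @[N --> \oo] --> +oo.
  apply: ger_cvgy (@cvgr_idn R); apply: nearW => N; exact: hermite_dim_ge.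
have DV : (hermite_dim N beta)^-1 @[N --> \oo] --> (0 : R).
  apply/gtr0_cvgV0 => //; near=> N; apply: hermite_dim_gt0 => //.
  by near: N; exact: nbhs_infty_gt.
elim: k => [|k IH].
  by rewrite /trace_moment; under eq_fun do rewrite big_ord0; exact: cvg_cst.
have kV : 1 + 2 * k%:R / hermite_dim N beta @[N --> \oo] --> (1 : R).
  have : 2 * k%:R / hermite_dim N beta @[N --> \oo] --> 2 * k%:R * (0 : R) by exact: cvgMr.
  by rewrite mulr0 => /(cvgD (cvg_cst (1 : R))); rewrite addr0.
rewrite /trace_moment; under eq_fun do rewrite big_ord_recr/=.
have H := cvgM IH kV; rewrite mulr1 in H; exact: H.
Unshelve. all: by end_near. Qed.

End ratio.

Theorem theorem8 (R : realType) (beta s : R)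
    (etaa : forall N : nat, 'I_N -> R) (etab : forall N : nat, 'I_N.-1 -> R)
    (beta_gt0 : 0 < beta) (s_ge0 : 0 <= s)
    (etaa_ge0 : forall N : nat, (2 <= N)%N -> forall j, 0 <= etaa N j)
    (etab_ge0 : forall N : nat, (2 <= N)%N -> forall j, 0 <= etab N j)
    (eta_sum : forall N : nat, (2 <= N)%N ->
       \sum_(j < N) etaa N j + \sum_(j < N.-1) etab N j = s)
    (M_defined : forall N : nat, (2 <= N)%N ->
       moment_defined (hermite_ensemble N beta) (etaa N) (etab N))
    (M_neq0 : forall N : nat, (2 <= N)%N ->
       moment (hermite_ensemble N beta) (etaa N) (etab N) <> 0) :
  (fun N : nat =>
     moment (fixed_trace_ensemble N beta (strength N beta)) (etaa N) (etab N) /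
     moment (hermite_ensemble N beta) (etaa N) (etab N)) @ \oo --> (1 : R).
Proof.
set u := (X in X @ _ --> _); have b0 := ltW beta_gt0.
(* delta N is the second moment of y^k - 1; the bound is at most e as soon as
   |delta N| <= e^2. *)
pose k := (Num.truncn (s / 2)).+1.
have sk : s / 2 <= k%:R by rewrite ltW// truncnS_gt.
pose delta N : R := trace_moment (hermite_dim N beta) (k + k) -
  2 * trace_moment (hermite_dim N beta) k + 1.
have delta0 : delta N @[N --> \oo] --> (0 : R).
  have -> : (0 : R) = 1 - 2 * 1 + 1 by ring.
  apply: cvgD; last exact: cvg_cst.
  apply: cvgB; first exact: cvg_trace_moment.
  by apply: cvgMr; exact: cvg_trace_moment.
have uV : (fun N => (u N)^-1) @ \oo --> (1 : R).
  apply/cvgrPdist_le => e e0; near=> N.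
  have N2 : (2 <= N)%N by near: N; exact: nbhs_infty_ge.
  apply: le_trans (moment_ratio_bound N2 b0 (etaa_ge0 N N2) (etab_ge0 N N2)
    (eta_sum N N2) (M_defined N N2) (M_neq0 N N2) e0 sk) _.
  rewrite -/(delta N) ler_pdivrMr// mulr_natr mulr2n lerD2l ler_pdivrMr//.
  near: N; have /cvgrPdist_le /(_ _ (mulr_gt0 e0 e0)) := delta0.
  by apply: filterS => N; rewrite sub0r normrN.
rewrite (_ : u = fun N => ((u N)^-1)^-1); last by apply/funext => N; rewrite invrK.
have H := cvgV (oner_neq0 R) uV; rewrite invr1 in H; exact: H.
Unshelve. all: by end_near. Qed.
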